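(* Let $\nu>0$, and let $\{p_{n,\nu}\}_{n=0}^\infty$ be the monic sequence of orthogonal polynomials with respect to $\mathcal{L}$. Then for every $n\in\mathbb{N}\cup\{0\}$, $$p_{n,\nu}(x)=\frac{2}{q_{n,\nu}(1/\nu)}\,\frac{q_{n,\nu}(1/\nu)\,q_{n+2,\nu}(x)-q_{n,\nu}(x)\,q_{n+2,\nu}(1/\nu)}{x^2-\nu^{-2}}.$$
   Context: For $\nu>0$, $J_\nu$ is the Bessel function of the first kind, $0<j'_{\nu,1}<j'_{\nu,2}<\cdots$ are the positive zeros of its derivative $J_\nu'$, and $j'_{\nu,-k}=-j'_{\nu,k}$ for $k\in\mathbb{N}$; one has $\nu<j'_{\nu,1}$. The moment functional $\mathcal{L}$ is defined on polynomials by $$\mathcal{L}(f)=\sum_{k\in\mathbb{Z}\setminus\{0\}}\frac{1}{(j'_{\nu,k})^2}\,f(1/j'_{\nu,k}).$$ It is positive definite. Its moments are the Rayleigh-type sums $\mathcal{L}(x^n)=\sum_{k\in\mathbb{Z}\setminus\{0\}}(j'_{\nu,k})^{-n-2}$. The monic orthogonal polynomials with respect to $\mathcal{L}$ are the monic polynomials $p_{n,\nu}$ of degree $n$ with $\mathcal{L}(p_{m,\nu}p_{n,\nu})=0$ for $m\ne n$. The polynomials $q_{n,\nu}$ are defined by $q_{0,\nu}(x)=1$, $q_{1,\nu}(x)=x/2$ and $q_{n+1,\nu}(x)=x\,q_{n,\nu}(x)-\beta_n q_{n-1,\nu}(x)$ for $n\ge1$, where $\beta_n=\frac{1}{4(\nu+n-1)(\nu+n)}$.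 *)

(* Defs.v *)
From HB Require Import structures.
From mathcomp Require Import all_boot all_order all_algebra.
From mathcomp Require Import all_classical all_reals all_analysis.
Set Implicit Arguments.
Unset Strict Implicit.
Unset Printing Implicit Defensive.
Import Order.TTheory GRing.Theory Num.Theory.
Import numFieldNormedType.Exports.
Local Open Scope classical_set_scope.
Local Open Scope ring_scope.

(* Euler's integral; meaningful for 0 < x. *)
Definition Gamma {R : realType} (x : R) : R :=
  \int[@lebesgue_measure R]_(t in `]0, +oo[) (t `^ (x - 1) * expR (- t)).

(* The real power (x / 2) `^ (nu + 2 m) makes this the Bessel function of the
   first kind only for 0 < x, which is the only range used below. *)
Definition besselJ {R : realType} (nu x : R) : R :=
  limn (series (fun m : nat =>
    (-1) ^+ m / (m`!%:R * Gamma (m%:R + nu + 1)) *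
    (x / 2) `^ (2 * m%:R + nu))).

(* [j] lists the zeros j'_{nu,k} of the derivative of J_nu: the [j k] with
   [0 < k] are the positive zeros in increasing order, and
   [j (- k) = - j k].  The (irrelevant) value [j 0] is forced to be 0. *)
Definition besselJ'_zeros {R : realType} (nu : R) (j : int -> R) : Prop :=
  [/\ forall k l : int, 0 < k -> k < l -> j k < j l,
      forall x : R, (0 < x /\ derive1 (besselJ nu) x = 0) <->
                    (exists2 k : int, 0 < k & x = j k) &
      forall k : int, j (- k) = - j k].

(* The sum over the nonzero integers is the sum of its two halves, k > 0 and
   k < 0; both series converge absolutely. *)
Definition momentL {R : realType} (j : int -> R) (f : {poly R}) : R :=
  let a (k : int) : R := 1 / j k ^+ 2 * f.[1 / j k] in
  limn (series (fun i : nat => a (i.+1)%:Z)) +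
  limn (series (fun i : nat => a (- (i.+1)%:Z))).

Definition monic_orthogonal {R : realType} (L : {poly R} -> R)
    (p : nat -> {poly R}) : Prop :=
  [/\ forall n, p n \is monic,
      forall n, size (p n) = n.+1 &
      forall m n, m <> n -> L (p m * p n) = 0].

Definition beta {R : realType} (nu : R) (n : nat) : R :=
  1 / (4 * (nu + n%:R - 1) * (nu + n%:R)).

Fixpoint q {R : realType} (nu : R) (n : nat) : {poly R} :=
  match n with
  | 0 => 1
  | 1 => 2^-1 *: 'X
  | (n'.+1 as m).+1 => 'X * q nu m - beta nu m *: q nu n'
  end.

(* Main.v *)
Require Import Defs.
From HB Require Import structures.
From mathcomp Require Import all_boot all_order all_algebra.
From mathcomp Require Import all_classical all_reals all_analysis.
From mathcomp Require Import measurable_realfun.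
From mathcomp Require Import ring lra zify.
Import Order.TTheory GRing.Theory Num.Theory.
Import numFieldNormedType.Exports.
Set Implicit Arguments.
Unset Strict Implicit.
Unset Printing Implicit Defensive.
Local Open Scope ring_scope.

(** With [s = z^2 / 4] and the factor [Gamma (nu + 1)] removed, [J_nu] and
    [z J_nu'] become (up to a power of [z]) entire series [A] and [B] in [s].
    The formal quotient [A / B] is the moment series of an even functional [L0],
    and the three-term recurrence of the Bessel functions shows that the Lommel
    type polynomials [lommel n] (rescaled [q_n]) are orthogonal for [L0].  At a
    zero of [J_nu'] one has [lommel n (2/z) = J_(nu+n)(z) / J_nu(z)], which decays
    so fast that the Christoffel-Darboux kernels at two nodes [+-2/j'_k] tend to
    [0] off the diagonal and to [j'_k^2 - nu^2] on it.  Hence, by Bessel's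
    inequality, the functional left after removing from [L0] the masses
    [1 / (j'_k^2 - nu^2)] at the first [K] pairs of nodes is still positive, so
    its even moments [mu_r] are log-convex.  Their series is [A_K / B_K], where
    [B_K] is [B] deflated at its first [K] zeros; the ratios [mu_r / mu_(r+1)]
    decrease to a zero of [B_K], and therefore are at least the [(K+1)]-st zero
    of [B].  Letting [K] grow, all the mass of [L0] sits at the nodes: no complex
    analysis is needed to see that [J_nu'] has no other zeros.  This gives
    [momentL f = L0 ((1 - nu^2 x^2) f)] up to the scaling of [x], and the
    theorem is the Christoffel formula for the factor [x^2 - nu^-2]. *)

(** * Entire series and their deflation *)

Section EntireSeries.
Variable R : realType.
Implicit Types (c d : nat -> R) (v W : R).
Local Open Scope classical_set_scope.

Lemma cvgr_sum (I : Type) (s : seq I) (P : pred I) (u : I -> nat -> R) (l : I -> R) :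
  (forall i, P i -> u i @ \oo --> l i) ->
  (fun n => \sum_(i <- s | P i) u i n) @ \oo --> \sum_(i <- s | P i) l i.
Proof. by move=> ul; apply: cvg_big => //; exact: add_continuous. Qed.

(** Equivalent to an infinite radius of convergence, but phrased as coefficient bounds so that
    shifts and deflations preserve it by direct estimates. *)
Definition entire c := forall C : R, 0 < C -> exists S, forall i, `|c i| * C ^+ i <= S.

Definition psum c v : R := limn (pseries c v).

Lemma entire_normed_cvg c v : entire c ->
  cvgn (series (fun i => `|c i * v ^+ i|)).
Proof.
(* Testing the bound at twice [|v| + 1] dominates the terms by a geometric series of ratio 1/2. *)
move=> ec; have v0 : 0 < 2 * (`|v| + 1) by have := normr_ge0 v; lra.
have [S cS] := ec _ v0.
apply: (@series_le_cvg _ _ (geometric S 2^-1)) => [i||i|].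
- exact: normr_ge0.
- move=> i; rewrite /geometric /=; apply: mulr_ge0; last by rewrite exprn_ge0.
  by apply: le_trans (cS 0%N); rewrite mulr_ge0// exprn_ge0// ltW.
- rewrite /geometric /= normrM normrX exprVn ler_pdivlMr ?exprn_gt0//.
  apply: le_trans (cS i); rewrite -mulrA -exprMn ler_wpM2l// lerXn2r ?nnegrE//;
    have := normr_ge0 v; lra.
- apply: is_cvg_geometric_series; rewrite gtr0_norm; lra.
Qed.

Lemma entire_cvg c v : entire c -> cvgn (pseries c v).
Proof. by move=> ec; apply: normed_cvg; exact: entire_normed_cvg. Qed.

Lemma psum_cvg c v : entire c -> pseries c v @ \oo --> psum c v.
Proof. by move=> /entire_cvg. Qed.

Lemma psum_unique c v (l : R) : pseries c v @ \oo --> l -> psum c v = l.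
Proof. by move=> cl; apply: (cvg_lim _ cl). Qed.

Lemma entireD c d : entire c -> entire d -> entire (fun i => c i + d i).
Proof.
move=> ec ed C C0; have [S cS] := ec _ C0; have [T dT] := ed _ C0.
exists (S + T) => i; apply: (le_trans _ (lerD (cS i) (dT i))).
by rewrite -mulrDl ler_wpM2r ?exprn_ge0 ?(ltW C0)// ler_normD.
Qed.

Lemma entireZ k c : entire c -> entire (fun i => k * c i).
Proof.
move=> ec C C0; have [S cS] := ec _ C0.
by exists (`|k| * S) => i; rewrite normrM -mulrA ler_wpM2l.
Qed.

(** The factor [i] is at most [2 ^ i], which the bound at [2 * C] absorbs. *)
Lemma entire_natmul c : entire c -> entire (fun i => i%:R * c i).
Proof.
move=> ec C C0; have [S cS] := ec (2 * C) (mulr_gt0 (ltr0n _ 2) C0).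
exists S => i; apply: le_trans (cS i).
rewrite normrM exprMn mulrCA mulrAC mulrC !mulrA.
rewrite ler_wpM2r ?exprn_ge0 ?(ltW C0)//.
rewrite [leRHS]mulrC ler_wpM2l// ger0_norm// -natrX ler_nat.
exact/ltnW/ltn_expl.
Qed.

Lemma psumD c d v : entire c -> entire d ->
  psum (fun i => c i + d i) v = psum c v + psum d v.
Proof.
move=> ec ed; apply: psum_unique.
rewrite (_ : pseries _ v = pseries c v \+ pseries d v).
  by apply: cvgD; exact: psum_cvg.
apply/funext => N; rewrite /pseries /series /= -big_split /=.
by apply: eq_bigr => i _; rewrite mulrDl.
Qed.

Lemma psumZ k c v : entire c -> psum (fun i => k * c i) v = k * psum c v.
Proof.
move=> ec; apply: psum_unique.
rewrite (_ : pseries _ v = (fun N => k * pseries c v N)).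
  by apply: cvgMr; exact: psum_cvg.
apply/funext => N; rewrite /pseries /series /= mulr_sumr.
by apply: eq_bigr => i _; rewrite mulrA.
Qed.

Lemma psum0 c : psum c 0 = c 0%N.
Proof.
apply: psum_unique; rewrite -cvg_shiftS; apply: cvg_near_cst.
near=> N; rewrite /pseries /series /= big_nat_recl//= expr0 mulr1.
by rewrite big1 ?addr0// => i _; rewrite expr0n mulr0.
Unshelve. all: by end_near. Qed.

(* coefficients of the quotient of [psum c] by [1 - v / W] *)
Fixpoint deflate W c r : R :=
  if r is r'.+1 then c r + deflate W c r' / W else c 0%N.

Lemma deflateE W c r : W != 0 ->
  deflate W c r * W ^+ r = \sum_(0 <= i < r.+1) c i * W ^+ i.
Proof.
move=> W0; elim: r => [|r IH]; first by rewrite big_nat1.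
by rewrite big_nat_recr//= -IH mulrDl addrC exprS !mulrA divfK.
Qed.

(** By [deflateE] the coefficient times [W ^+ r] is a partial sum of [psum c W]. As the whole sum is
    0, it is minus a tail, and the tail decays faster than any geometric sequence. *)
Lemma entire_deflate W c : 0 < W -> entire c -> psum c W = 0 ->
  entire (deflate W c).
Proof.
move=> W0 ec c0 C C0.
(* This choice gives [W / D <= 1/2], so the tails are geometric, and also [C <= D], so that
   [t * C <= W] in the last estimate. *)
pose D : R := 2 * (C + W); have D0 : 0 < D by rewrite /D; lra.
have [S cS] := ec _ D0.
have S0 : 0 <= S by apply: le_trans (cS 0%N); rewrite mulr_ge0// exprn_ge0// ltW.
exists S => r.
pose t : R := W / D.
have t0 : 0 < t by rewrite divr_gt0.
have t2 : t <= 2^-1 by rewrite /t ler_pdivrMr// /D; lra.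
have cW i : `|c i * W ^+ i| <= S * t ^+ i.
  rewrite normrM normrX (gtr0_norm W0) /t expr_div_n mulrA ler_pdivlMr ?exprn_gt0//.
  by rewrite mulrAC ler_wpM2r// exprn_ge0// ltW.
have geo N n : \sum_(N <= i < N + n) S * t ^+ i <= 2 * S * t ^+ N.
  elim: n N => [|n IH] N.
    by rewrite addn0 big_geq// !mulr_ge0// exprn_ge0// ltW.
  rewrite big_ltn ?addnS ?ltnS ?leq_addr//.
  rewrite -addSn; apply: le_trans (lerD (lexx _) (IH _)) _.
  rewrite exprS -subr_ge0.
  rewrite (_ : _ - _ = S * t ^+ N * (1 - 2 * t)); last by ring.
  by rewrite !mulr_ge0// ?exprn_ge0// ?(ltW t0)//; lra.
have tail : `|\sum_(0 <= i < r.+1) c i * W ^+ i| <= 2 * S * t ^+ r.+1.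
  have cvg0 : pseries c W @ \oo --> (0:R) by rewrite -c0; exact: psum_cvg.
  have cv2 : (fun n => `|pseries c W r.+1 - pseries c W n|) @ \oo --> `|pseries c W r.+1|.
    rewrite -[X in `|X|]subr0.
    by apply: cvg_norm; apply: cvgB => //; exact: cvg_cst.
  rewrite -[leLHS]/(`|pseries c W r.+1|) -(cvg_lim _ cv2)//.
  apply: limr_le; first exact: cvgP cv2.
  exists r.+1 => // n /= rn.
  rewrite distrC /pseries /series /= -(subnKC rn).
  rewrite [X in `|X - _|](@big_cat_nat _ _ _ r.+1)//= ?leq_addr// addrAC subrr add0r.
  apply: le_trans (ler_norm_sum _ _ _) _.
  by apply: le_trans (geo _ _); apply: ler_sum => i _; exact: cW.
rewrite -(ler_pM2r (exprn_gt0 r W0)) mulrAC.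
rewrite -[X in `|_| * X](gtr0_norm (exprn_gt0 r W0)) -normrM deflateE ?gt_eqF//.
apply: le_trans (ler_wpM2r (exprn_ge0 _ (ltW C0)) tail) _.
have -> : 2 * S * t ^+ r.+1 * C ^+ r = S * (2 * t * (t * C) ^+ r).
  by rewrite [(t * C) ^+ r]exprMn [t ^+ r.+1]exprS; ring.
rewrite ler_wpM2l// -[leRHS]mul1r; apply: ler_pM.
- by rewrite mulr_ge0// ltW.
- by rewrite exprn_ge0// mulr_ge0// ltW.
- lra.
- have tC0 : 0 <= t * C by rewrite mulr_ge0// ltW.
  rewrite lerXn2r ?nnegrE ?(ltW W0)// /t mulrAC ler_pdivrMr// ler_wpM2l ?(ltW W0)// /D; lra.
Qed.

Lemma psum_deflate W c v : entire (deflate W c) -> entire c ->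
  psum (deflate W c) v * (1 - v / W) = psum c v.
Proof.
move=> ed ec; apply/esym/psum_unique; rewrite -cvg_shiftS.
have dv := psum_cvg (v := v) ed.
rewrite (_ : [sequence _]_n = (fun N => pseries (deflate W c) v N.+1 -
  v / W * pseries (deflate W c) v N)).
  rewrite mulrBr mulr1 [_ * (v / W)]mulrC; apply: cvgB; last exact: cvgMr.
  by rewrite cvg_shiftS.
apply/funext => N; rewrite /pseries /series /=.
rewrite !big_nat_recl//= mulr_sumr -addrA -sumrB; congr (_ + _).
by apply: eq_bigr => i _; rewrite !exprS; ring.
Qed.

(** This is l'Hopital's rule for the quotient by [1 - v / W] at [W]. Summation by parts replaces the
    differentiation: the two partial sums add up to a boundary term that tends to 0. *)
Lemma psum_deflate_root W c : 0 < W -> entire c -> psum c W = 0 ->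
  psum (deflate W c) W = - psum (fun i => i%:R * c i) W.
Proof.
move=> W0 ec c0; have ed := entire_deflate W0 ec c0.
apply/eqP; rewrite -addr_eq0; apply/eqP.
rewrite addrC; have ei := entire_natmul ec; have edi := entire_natmul ed.
have : pseries (fun i => i%:R * c i) W \+ pseries (deflate W c) W @ \oo -->
    psum (fun i => i%:R * c i) W + psum (deflate W c) W.
  by apply: cvgD; exact: psum_cvg.
have/cvg_series_cvg_0 : cvgn (pseries (fun i => i%:R * deflate W c i) W).
  exact: entire_cvg.
have/cvg_series_cvg_0 d0 : cvgn (pseries (deflate W c) W) by exact: entire_cvg.
move=> di0; rewrite -cvg_shiftS => lim1.
rewrite -(cvg_lim _ lim1)//; apply/cvg_lim => //.
rewrite (_ : (fun _ => _) = (fun n => n%:R * deflate W c n * W ^+ n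
   + deflate W c n * W ^+ n)).
  by rewrite -[X in _ --> X]addr0; exact: cvgD.
apply/funext; elim=> [|N IH].
  by rewrite /pseries /series /= !big_nat1 !mul0r !add0r.
move: IH; rewrite /pseries /series /= => IH.
rewrite [X in X + _]big_nat_recr//= [X in _ + X]big_nat_recr//= addrACA IH.
rewrite exprS -!natr1; field; by rewrite gt_eqF.
Qed.

(** Partial fractions for [1 / ((1 - v / V) (1 - v / W))], read on coefficients. *)
Lemma deflate2 V W c r : deflate V (deflate W c) r * (V^-1 - W^-1) =
  deflate V c r / V - deflate W c r / W.
Proof.
elim: r => [|r IH] /=; first by rewrite mulrBr.
by rewrite mulrDl mulrAC IH; ring.
Qed.

Lemma deflate_comm V W c r :
  deflate V (deflate W c) r = deflate W (deflate V c) r.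
Proof.
elim: r => [|r IH] //=; rewrite -IH.
by move: (deflate2 V W c r); set X := deflate V _ r => H; lra.
Qed.

(** Deflation is convolution with a geometric sequence, so it can be moved through any
    convolution. *)
Lemma conv_deflate W b (m : nat -> R) r :
  \sum_(0 <= i < r.+1) m i * deflate W b (r - i) =
  deflate W (fun n => \sum_(0 <= i < n.+1) m i * b (n - i)%N) r.
Proof.
elim: r => [|r IH]; first by rewrite /= !big_nat1.
rewrite [RHS]/= -IH big_nat_recr//= subnn [in RHS]big_nat_recr//= subnn /=.
rewrite mulr_suml addrAC -big_split /=; congr (_ + _).
by apply: eq_big_nat => i /andP[_ ir]; rewrite subSn//= mulrDr mulrA.
Qed.

Lemma conv_geometric W b r :
  \sum_(0 <= i < r.+1) W^-1 ^+ i * b (r - i)%N = deflate W b r.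
Proof.
elim: r => [|r IH]; first by rewrite big_nat1 mul1r.
rewrite big_nat_recl// mul1r subn0 /= -IH mulr_suml; congr (_ + _).
by apply: eq_bigr => i _; rewrite subSS exprS; ring.
Qed.

Lemma deflateDZ W c d k r :
  deflate W (fun i => c i + k * d i) r = deflate W c r + k * deflate W d r.
Proof. by elim: r => [|r IH] //=; rewrite IH; ring. Qed.

End EntireSeries.

(** * Ratios of log-convex moments and zeros of the denominator *)

Section MomentRatio.
Variables (R : realType) (mu a b : nat -> R) (W : R).
Local Open Scope classical_set_scope.
Hypotheses (ea : entire a) (eb : entire b).
Hypothesis b_neq0 : forall v, 0 <= v -> v < W -> psum b v != 0.
Hypothesis mu_ge0 : forall r, 0 <= mu r.
Hypothesis mu_logconvex : forall r, mu r.+1 ^+ 2 <= mu r * mu r.+2.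
Hypothesis conv_mu :
  forall r, \sum_(0 <= i < r.+1) mu i * b (r - i)%N = a r.

(* The ratios [mu r / mu r.+1] decrease to some [rho]; dividing the convolution
   identity by [mu r] and letting r grow gives [psum b rho = 0]. *)
Lemma moment_ratio r : W * mu r.+1 <= mu r.
Proof.
(* By log-convexity a zero moment propagates: either all moments from index 1 on vanish, or every
   moment is positive. *)
have [mu1|mu1] := eqVneq (mu 1%N) 0.
  have mu0 k : mu k.+1 = 0.
    elim: k => [|k IH] //; apply/eqP; rewrite -sqrf_eq0 eq_le sqr_ge0 andbT.
    by apply: le_trans (mu_logconvex _) _; rewrite IH mul0r.
  by rewrite mu0 mulr0.
have mugt k : 0 < mu k.
  have H : forall k, 0 < mu k.+1.
    elim=> [|l IH]; first by rewrite lt_def mu1 mu_ge0.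
    rewrite lt_def mu_ge0 andbT; apply/eqP => m0.
    by have := mu_logconvex l; rewrite m0 mulr0 leNgt exprn_gt0.
  case: k => // ; rewrite lt_def mu_ge0 andbT; apply/eqP => m0.
  by have := mu_logconvex 0; rewrite m0 mul0r leNgt exprn_gt0.
pose x k := mu k / mu k.+1.
have x_ge0 k : 0 <= x k by rewrite divr_ge0.
have xS k : x k.+1 <= x k.
  by rewrite /x ler_pdivrMr// mulrAC ler_pdivlMr// -expr2.
have x_dec : {homo x : n m / (n <= m)%N >-> m <= n}.
  by apply/nonincreasing_seqP.
have x_cvg : cvgn x.
  apply: nonincreasing_is_cvgn => //; exists 0 => _ [k _ <-]; exact: x_ge0.
pose rho : R := limn x.
have x_rho : x @ \oo --> rho by [].
have rho_le k : rho <= x k by exact: nonincreasing_cvgn_ge.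
have rho_ge0 : 0 <= rho by apply: limr_ge => //; near=> k; exact: x_ge0.
pose C := x 0%N.
have C_gt0 : 0 < C by rewrite divr_gt0.
have ratioE k i : mu k / mu (k + i.+1)%N = x k * (mu k.+1 / mu (k.+1 + i)%N).
  by rewrite /x addnS addSn; field; rewrite !gt_eqF.
have ratio_cvg i : (fun k => mu k / mu (k + i)%N) @ \oo --> rho ^+ i.
  elim: i => [|i IH].
    apply: cvg_near_cst; near=> k; rewrite addn0 divff// gt_eqF//.
  under eq_fun do rewrite ratioE.
  by rewrite exprS; apply: cvgM => //; move: IH; rewrite -cvg_shiftS.
have ratio_le k i : mu k / mu (k + i)%N <= C ^+ i.
  elim: i k => [|i IH] k; first by rewrite addn0 divff// gt_eqF.
  rewrite ratioE exprS; apply: ler_pM => //; first by rewrite divr_ge0.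
  exact: x_dec.
(* [C] is the largest ratio; the coefficient bounds at [2 * C] leave a factor [2^-1 ^+ i] after
   [C ^+ i] is spent on the ratios. *)
have C2_gt0 : 0 < 2 * C by lra.
have [S bS] := eb C2_gt0; have [T aT] := ea C2_gt0.
have geomE D (c : nat -> R) : (forall i, `|c i| * (2 * C) ^+ i <= D) ->
    forall i, `|c i| * C ^+ i <= D * 2^-1 ^+ i.
  move=> cD i; rewrite exprVn ler_pdivlMr ?exprn_gt0// -mulrA -exprMn.
  by rewrite [C * 2]mulrC.
have b_geo := geomE _ _ bS; have a_geo := geomE _ _ aT.
have geo N n : \sum_(N <= i < N + n) S * 2^-1 ^+ i <= 2 * S * 2^-1 ^+ N.
  have S0 : 0 <= S by apply: le_trans (bS 0%N); rewrite mulr_ge0// exprn_ge0// ltW.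
  elim: n N => [|n IH] N.
    by rewrite addn0 big_geq// !mulr_ge0// exprn_ge0.
  rewrite big_ltn ?addnS ?ltnS ?leq_addr//.
  rewrite -addSn; apply: le_trans (lerD (lexx _) (IH _)) _.
  by rewrite exprS; lra.
have half0 : (fun k => 2^-1 ^+ k) @ \oo --> (0 : R).
  by apply: cvg_expr; rewrite gtr0_norm; lra.
(* Here [u k] is the convolution identity at index [k + N], divided by [mu (k + N)] and cut after
   [N] terms. It tends to the partial sum at [rho], while the terms cut off and the term from [a]
   are geometrically small. *)
have partial N : `|pseries b rho N| <= 2 * S * 2^-1 ^+ N.
  pose u k := \sum_(0 <= i < N) b i * (mu (k + N - i)%N / mu (k + N)%N).
  have u_cvg : u @ \oo --> pseries b rho N.
    rewrite /pseries /series /= big_mkord.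
    rewrite (_ : u = fun k => \sum_(i < N) b i * (mu (k + N - i)%N / mu (k + N)%N)); last first.
      by apply/funext => k; rewrite /u big_mkord.
    apply: cvgr_sum => i _; apply: cvgMr.
    have iN := ltnW (ltn_ord i).
    move: (ratio_cvg i); rewrite -(cvg_shiftn (N - i)) /=.
    apply: cvg_trans; apply: near_eq_cvg; near=> k.
    by rewrite addnBA// subnK// (leq_trans iN)// leq_addl.
  have u_le k : `|u k| <= 2 * S * 2^-1 ^+ N + T / mu 0%N * 2^-1 ^+ (k + N).
    have uE : u k = a (k + N)%N / mu (k + N)%N -
        \sum_(N <= i < (N + k.+1)) b i * (mu (k + N - i)%N / mu (k + N)%N).
      apply/eqP; rewrite eq_sym subr_eq; apply/eqP.
      rewrite /u -big_cat_nat //= ?leq_addr// -conv_mu mulr_suml.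
      rewrite big_nat_rev /= add0n addnS addnC; apply: eq_big_nat => i /andP[_ ik].
      by rewrite subSS mulrA [b i * _]mulrC subKn.
    rewrite uE [leRHS]addrC; apply: le_trans (ler_normB _ _) _; apply: lerD; last first.
      apply: le_trans (ler_norm_sum _ _ _) _; apply: le_trans (geo N k.+1).
      apply: ler_sum_nat => i /andP[Ni ik].
      rewrite normrM (ger0_norm (divr_ge0 _ _))//.
      apply: le_trans (b_geo i); apply: ler_wpM2l => //.
      have {2}-> : (k + N = (k + N - i) + i)%N by rewrite subnK// addnC -ltnS -addnS.
      exact: ratio_le.
    rewrite normrM normfV (gtr0_norm (mugt _)).
    apply: (@le_trans _ _ (`|a (k + N)%N| * C ^+ (k + N) / mu 0%N)).
      rewrite -mulrA ler_wpM2l//.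
      rewrite ler_pdivlMr// mulrC; exact: (ratio_le 0%N).
    by rewrite [leRHS]mulrAC ler_wpM2r ?invr_ge0.
  have bd : (fun k => 2 * S * 2^-1 ^+ N + T / mu 0%N * 2^-1 ^+ (k + N)) @ \oo
      --> 2 * S * 2^-1 ^+ N.
    rewrite -[X in _ --> X]addr0; apply: cvgD; first exact: cvg_cst.
    rewrite -(mulr0 (T / mu 0%N)); apply: cvgMr.
    by rewrite (cvg_shiftn N (fun k => 2^-1 ^+ k : R)).
  have nu_cvg : (fun k => `|u k|) @ \oo --> `|pseries b rho N| by exact: cvg_norm.
  rewrite -(cvg_lim _ nu_cvg)// -(cvg_lim _ bd)//.
  apply: ler_lim; [exact: cvgP nu_cvg|exact: cvgP bd|by near=> k].
have rho0 : psum b rho = 0.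
  apply: psum_unique; apply/norm_cvg0P.
  apply: (@squeeze_cvgr _ _ _ _ (fun=> 0) (fun N => 2 * S * 2^-1 ^+ N)).
  - by near=> N; rewrite normr_ge0 partial.
  - exact: cvg_cst.
  - by rewrite -(mulr0 (2 * S)); exact: cvgMr.
have : W <= rho.
  by rewrite leNgt; apply/negP => /(b_neq0 rho_ge0); rewrite rho0 eqxx.
by move=> /le_trans /(_ (rho_le r)); rewrite /x ler_pdivlMr.
Unshelve. all: by end_near. Qed.

End MomentRatio.

(** * Removing the poles of the quotient one at a time *)

Section ResidualMoments.
Variables (R : realType) (s kappa m a b : nat -> R).
Local Open Scope classical_set_scope.
Hypotheses (ea : entire a) (eb : entire b) (b0 : b 0%N != 0).
Hypothesis conv_m :
  forall r, \sum_(0 <= i < r.+1) m i * b (r - i)%N = a r.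
Hypothesis s_gt0 : forall k, 0 < s k.
Hypothesis s_inc : forall k l, (k < l)%N -> s k < s l.
Hypothesis b_zeros : forall v, 0 < v -> psum b v = 0 <-> exists k, v = s k.
Hypothesis a_neq0 : forall k, psum a (s k) != 0.
Hypothesis residue :
  forall k, psum a (s k) = kappa k * psum (deflate (s k) b) (s k).

Definition residual K r : R := m r - \sum_(0 <= k < K) kappa k * (s k)^-1 ^+ r.

Fixpoint den K : nat -> R :=
  if K is K'.+1 then deflate (s K') (den K') else b.

Fixpoint num K : nat -> R :=
  if K is K'.+1 then deflate (s K') (fun i => num K' i + - kappa K' * den K i)
  else a.

Let s_neq k l : k != l -> 1 - s k / s l != 0.
Proof.
move=> kl; rewrite subr_eq0 eq_sym -subr_eq0 -(divff (lt0r_neq0 (s_gt0 l))) -mulrBl.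
rewrite mulf_neq0 ?invr_eq0 ?subr_eq0 ?(lt0r_neq0 (s_gt0 _))//.
case: (ltngtP k l) kl => // kl _; first by rewrite lt_eqF// s_inc.
by rewrite gt_eqF// s_inc.
Qed.

Let entire_num' K : entire (num K) -> entire (den K.+1) ->
  entire (fun i => num K i + - kappa K * den K.+1 i).
Proof. by move=> en ed; apply: entireD => //; exact: entireZ. Qed.

(* [num K / den K] is the quotient [a / b] minus its poles at the first [K] zeros. *)
Lemma residual_conv K :
  [/\ entire (den K), entire (num K),
      forall r, \sum_(0 <= i < r.+1) residual K i * den K (r - i)%N = num K r,
      forall k, (K <= k)%N -> [/\ psum (den K) (s k) = 0,
        psum (num K) (s k) != 0 &
        psum (num K) (s k) = kappa k * psum (deflate (s k) (den K)) (s k)] &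
      [/\ den K 0%N = b 0%N,
        forall k, (k < K)%N -> psum (den K) (s k) != 0 &
        forall v, psum (den K) v = 0 -> psum b v = 0]].
Proof.
elim: K => [|K [eB eA convK root [B0 nroot sub]]].
  split=> //; first by move=> r; rewrite [RHS]/= -conv_m; apply: eq_big_nat => i _;
    rewrite /residual big_nil subr0.
  move=> k _; split=> //.
  by apply/b_zeros => //; exists k.
have [rootK numK resK] := root K (leqnn K).
have eB' : entire (den K.+1) by exact: entire_deflate.
have eA0 := entire_num' eA eB'.
have A0E v : psum (fun i => num K i + - kappa K * den K.+1 i) v =
    psum (num K) v - kappa K * psum (den K.+1) v.
  by rewrite psumD ?psumZ//; [rewrite mulNr|exact: entireZ].
(* The residue hypothesis says exactly that the new numerator vanishes at [s K], so deflation keeps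
   it entire. *)
have eA' : entire (num K.+1).
  by apply: entire_deflate => //; rewrite A0E resK subrr.
have BE v : psum (den K.+1) v * (1 - v / s K) = psum (den K) v.
  exact: psum_deflate.
have AE v : psum (num K.+1) v * (1 - v / s K) =
    psum (num K) v - kappa K * psum (den K.+1) v.
  by rewrite -A0E; exact: psum_deflate.
have Broot k : (K < k)%N -> psum (den K.+1) (s k) = 0.
  move=> Kk; have [r _ _] := root k (ltnW Kk).
  apply/eqP; have/eqP := BE (s k).
  by rewrite r mulf_eq0 (negPf (s_neq _)) ?orbF// gtn_eqF.
split=> //.
- move=> r; rewrite [RHS]/= deflateDZ -(conv_geometric (s K) (den K.+1)).
  have -> : deflate (s K) (num K) r = deflate (s K) (fun n =>
      \sum_(0 <= i < n.+1) residual K i * den K (n - i)%N) r.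
    by congr deflate; apply/funext.
  rewrite -conv_deflate mulr_sumr -big_split; apply: eq_bigr => i _.
  by rewrite /residual big_nat_recr//=; ring.
- move=> k Kk; have [rk nk resk] := root k (ltnW Kk).
  have sk : 1 - s k / s K != 0 by rewrite s_neq// gtn_eqF.
  have AEk := AE (s k); rewrite Broot// mulr0 subr0 in AEk.
  split; first exact: Broot.
    by apply/eqP => n0; move: nk; rewrite -AEk n0 mul0r eqxx.
  (* The residue identity at a later pole survives because both sides are divided by the same factor
     [1 - s k / s K], deflations at [s k] and [s K] being interchangeable. *)
  apply: (mulIf sk); rewrite AEk resk -mulrA; congr (_ * _).
  have eD : entire (deflate (s k) (den K)) by exact: entire_deflate.
  have eDD : entire (deflate (s K) (deflate (s k) (den K))).
    apply: entire_deflate => //; apply/eqP.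
    have /eqP := psum_deflate (s K) eD eB.
    by rewrite rootK mulf_eq0 (negPf (s_neq _)) ?orbF// ltn_eqF.
  rewrite -(psum_deflate _ eDD eD); congr (_ * _); congr psum.
  by apply/funext => r; rewrite deflate_comm.
split; first by [].
  move=> k; rewrite ltnS leq_eqVlt => /predU1P[->|kK].
    apply/eqP => n0; move: numK; rewrite resK.
    by rewrite -[psum (deflate _ _) _]/(psum (den K.+1) (s K)) n0 mulr0 eqxx.
  by apply/eqP => n0; have := nroot k kK; rewrite -BE n0 mul0r eqxx.
by move=> v v0; apply: sub; rewrite -BE v0 mul0r.
Qed.

Hypothesis residual_ge0 : forall K r, 0 <= residual K r.
Hypothesis residual_logconvex :
  forall K r, residual K r.+1 ^+ 2 <= residual K r * residual K r.+2.

(** [den K] keeps only those zeros of [b] that start at [s K], and its value at 0 is [b 0]; hence it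
    does not vanish on [[0, s K)] and [moment_ratio] applies with [W = s K]. *)
Lemma residual_ratio K r : s K * residual K r.+1 <= residual K r.
Proof.
have [eB eA convK _ [B0 nroot sub]] := residual_conv K.
apply: (moment_ratio eA eB) => // v; rewrite le_eqVlt => /predU1P[<- _|v0 vK].
  by rewrite psum0 B0.
apply/eqP => Bv; have /(b_zeros v0)[k vk] := sub _ Bv.
have kK : (k < K)%N.
  rewrite ltnNge leq_eqVlt; apply/negP => /predU1P[Kk|/s_inc].
    by move: vK; rewrite vk Kk ltxx.
  by rewrite -vk => /lt_trans /(_ vK); rewrite ltxx.
by have := nroot k kK; rewrite -vk Bv eqxx.
Qed.

Hypothesis kappa_ge0 : forall k, 0 <= kappa k.
Hypothesis s_cvgy : s @ \oo --> +oo.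

(** The ratio bound gives [residual K r.+1 <= m r / s K], and [s K] tends to infinity. The moment of
    index 0 escapes this argument. *)
Lemma residual_cvg0 r : (fun K => residual K r.+1) @ \oo --> (0 : R).
Proof.
have le_m K : residual K r <= m r.
  rewrite /residual gerBl sumr_ge0// => k _.
  by rewrite mulr_ge0// exprn_ge0// invr_ge0 ltW.
apply: (@squeeze_cvgr _ _ _ _ (fun=> 0) (fun K => m r * (s K)^-1)).
- near=> K; rewrite residual_ge0 ler_pdivlMr// mulrC.
  exact: le_trans (residual_ratio _ _) (le_m K).
- exact: cvg_cst.
- rewrite -(mulr0 (m r)); apply: cvgMr.
  by apply/gtr0_cvgV0 => //; near=> k.
Unshelve. all: by end_near. Qed.

End ResidualMoments.

(** * Moment functionals and orthogonal polynomials *)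

Section MomentFunctional.
Variables (R : realType) (mom : nat -> R).
Implicit Types f g : {poly R}.

Definition momfun f : R := \sum_(i < size f) f`_i * mom i.

Lemma momfun_widen N f : (size f <= N)%N -> momfun f = \sum_(i < N) f`_i * mom i.
Proof.
move=> fN; rewrite /momfun (big_ord_widen N (fun i => f`_i * mom i))//.
rewrite big_mkcond; apply: eq_bigr => i _; case: ltnP => // /(nth_default 0) ->.
by rewrite mul0r.
Qed.

Lemma momfun_linear k f g : momfun (k *: f + g) = k * momfun f + momfun g.
Proof.
have fN : (size f <= maxn (size f) (size g))%N by rewrite leq_maxl.
have gN : (size g <= maxn (size f) (size g))%N by rewrite leq_maxr.
rewrite (momfun_widen fN) (momfun_widen gN) (@momfun_widen (maxn (size f) (size g))).
  rewrite mulr_sumr -big_split; apply: eq_bigr => i _.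
  by rewrite coefD coefZ /=; ring.
by apply: leq_trans (size_polyD _ _) _; rewrite geq_max gN (leq_trans (size_scale_leq _ _)).
Qed.

Lemma momfun0 : momfun 0 = 0.
Proof. by rewrite /momfun size_poly0 big_ord0. Qed.

Lemma momfunZ k f : momfun (k *: f) = k * momfun f.
Proof. by have := momfun_linear k f 0; rewrite addr0 momfun0 addr0. Qed.

Lemma momfunD f g : momfun (f + g) = momfun f + momfun g.
Proof. by have := momfun_linear 1 f g; rewrite scale1r mul1r. Qed.

Lemma momfunB f g : momfun (f - g) = momfun f - momfun g.
Proof. by rewrite -scaleN1r momfunD momfunZ mulN1r. Qed.

Lemma momfun_sum (I : Type) (r : seq I) (P : pred I) (F : I -> {poly R}) :
  momfun (\sum_(i <- r | P i) F i) = \sum_(i <- r | P i) momfun (F i).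
Proof. by apply: (big_morph momfun momfunD momfun0). Qed.

Lemma momfunXn k : momfun 'X^k = mom k.
Proof.
rewrite /momfun size_polyXn (bigD1 ord_max)//= coefXn eqxx mul1r big1 ?addr0//.
move=> i ik; rewrite coefXn (_ : (i == k :> nat) = false) ?mul0r//.
by apply: contraNF ik => /eqP ik; apply/eqP/val_inj.
Qed.

End MomentFunctional.

(** * Christoffel-Darboux kernels and Bessel's inequality *)

Section OrthogonalPolynomials.
Variables (R : realType) (mom : nat -> R) (P : nat -> {poly R}) (h : nat -> R).
Local Open Scope classical_set_scope.
Local Notation L := (momfun mom).
Hypothesis size_P : forall n, size (P n) = n.+1.
Hypothesis ortho : forall n k, L (P n * P k) = (n == k)%:R * h n.
Hypothesis h_gt0 : forall n, 0 < h n.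

Lemma basis_expansion N (f : {poly R}) : (size f <= N)%N ->
  exists c : nat -> R, f = \sum_(n < N) c n *: P n.
Proof.
elim: N f => [|N IH] f.
  rewrite leqn0 size_poly_eq0 => /eqP ->.
  by exists (fun=> 0); rewrite big_ord0.
move=> fN; pose k := f`_N / lead_coef (P N).
have [|c cE] := IH (f - k *: P N).
  apply/leq_sizeP => i; rewrite leq_eqVlt => /predU1P[<-|Ni].
    have PN : (P N)`_N = lead_coef (P N) by rewrite lead_coefE size_P.
    by rewrite coefB coefZ PN divfK ?subrr// lead_coef_eq0 -size_poly_eq0 size_P.
  by rewrite coefB coefZ !nth_default ?mulr0 ?subrr ?size_P// (leq_trans fN).
exists (fun n => if n == N then k else c n).
rewrite big_ord_recr /= eqxx -[LHS](subrK (k *: P N)) cE; congr (_ + _).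
by apply: eq_bigr => i _; rewrite ltn_eqF.
Qed.

Lemma momfun_pair N (c d : nat -> R) :
  L ((\sum_(n < N) c n *: P n) * (\sum_(n < N) d n *: P n)) =
  \sum_(n < N) c n * d n * h n.
Proof.
rewrite mulr_suml momfun_sum; apply: eq_bigr => n _.
rewrite mulr_sumr momfun_sum (bigD1 n)//= big1 ?addr0.
  by rewrite -scalerAl -scalerAr !momfunZ ortho eqxx mul1r mulrA.
move=> k kn; rewrite -scalerAl -scalerAr !momfunZ ortho.
by rewrite (_ : (n == k :> nat) = false) ?mul0r ?mulr0// eq_sym; apply: negbTE.
Qed.

(** The Christoffel-Darboux kernel as a polynomial in its first variable; it represents evaluation
    at [v] on polynomials of size at most [N]. *)
Definition ckernel N v : {poly R} := \sum_(n < N) ((P n).[v] / h n) *: P n.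

Lemma ckernelE N u v :
  (ckernel N v).[u] = \sum_(n < N) (P n).[u] * (P n).[v] / h n.
Proof.
by rewrite horner_sum; apply: eq_bigr => n _; rewrite hornerZ mulrC mulrA.
Qed.

Lemma momfun_ckernel N v : L (ckernel N v * ckernel N v) = (ckernel N v).[v].
Proof.
pose c n := (P n).[v] / h n.
rewrite ckernelE (momfun_pair _ c c); apply: eq_bigr => n _.
by rewrite /c; field; rewrite gt_eqF.
Qed.

(** For [N] at least the size of [f], [G N] is the value of [L] on the square of [f] minus the
    combination of kernels at the [y i] with coefficients [lam i * f.[y i]]. In the limit the double
    sum becomes diagonal and cancels half of the middle term. *)
Lemma bessel_inequality (I : finType) (y lam : I -> R) (f : {poly R}) :
  (forall i, 0 < lam i) ->
  (forall i k, (fun N => (ckernel N (y i)).[y k]) @ \oo --> (i == k)%:R / lam i) ->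
  \sum_i lam i * f.[y i] ^+ 2 <= L (f * f).
Proof.
move=> lam_gt0 K_cvg.
pose x i := lam i * f.[y i].
pose G N := L (f * f) - 2 * (\sum_i x i * f.[y i]) +
  \sum_i \sum_k x i * x k * (ckernel N (y i)).[y k].
have G_ge0 N : (size f <= N)%N -> 0 <= G N.
  move=> /basis_expansion[c fE].
  have fyE v : f.[v] = \sum_(n < N) c n * (P n).[v].
    by rewrite fE horner_sum; apply: eq_bigr => n _; rewrite hornerZ.
  have -> : G N = \sum_(n < N) h n * (c n - \sum_i x i * (P n).[y i] / h n) ^+ 2.
    transitivity (\sum_(n < N) (c n * c n * h n
        - 2 * (\sum_i x i * (c n * (P n).[y i])) +
        \sum_i \sum_k x i * x k * ((P n).[y k] * (P n).[y i] / h n))).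
      rewrite big_split sumrB /G {1 2}fE momfun_pair; congr (_ - _ + _).
        rewrite -mulr_sumr; congr (_ * _); rewrite exchange_big; apply: eq_bigr => i _.
        by rewrite fyE mulr_sumr.
      rewrite [RHS]exchange_big; apply: eq_bigr => i _.
      rewrite [RHS]exchange_big; apply: eq_bigr => k _.
      by rewrite ckernelE mulr_sumr.
    apply: eq_bigr => n _.
    have hn := lt0r_neq0 (h_gt0 n).
    set A := \sum_i x i * (P n).[y i].
    have -> : \sum_i x i * (P n).[y i] / h n = A / h n by rewrite mulr_suml.
    have -> : \sum_i x i * (c n * (P n).[y i]) = c n * A.
      by rewrite mulr_sumr; apply: eq_bigr => i _; ring.
    have -> : \sum_i \sum_k x i * x k * ((P n).[y k] * (P n).[y i] / h n) =
        A * A / h n.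
      rewrite mulr_suml mulr_suml; apply: eq_bigr => i _.
      rewrite mulr_sumr mulr_suml; apply: eq_bigr => k _; ring.
    by field.
  by apply: sumr_ge0 => n _; rewrite mulr_ge0 ?sqr_ge0// ltW.
have G_cvg : G @ \oo --> L (f * f) - 2 * (\sum_i x i * f.[y i]) +
    \sum_i \sum_k x i * x k * ((i == k)%:R / lam i).
  apply: cvgD; first exact: cvg_cst.
  by apply: cvgr_sum => i _; apply: cvgr_sum => k _; apply: cvgMr.
have : 0 <= L (f * f) - 2 * (\sum_i x i * f.[y i]) +
    \sum_i \sum_k x i * x k * ((i == k)%:R / lam i).
  rewrite -(cvg_lim _ G_cvg)//; apply: limr_ge; first exact: cvgP G_cvg.
  by near=> N; apply: G_ge0; near: N; exists (size f).
have -> : \sum_i \sum_k x i * x k * ((i == k)%:R / lam i) = \sum_i x i * f.[y i].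
  apply: eq_bigr => i _; rewrite (bigD1 i)//= eqxx big1 ?addr0.
    by rewrite /x -[true%:R]/(1 : R); field; rewrite gt_eqF.
  by move=> k /negPf ki; rewrite eq_sym ki mul0r mulr0.
have -> : \sum_i x i * f.[y i] = \sum_i lam i * f.[y i] ^+ 2.
  by apply: eq_bigr => i _; rewrite /x -mulrA -expr2.
lra.
Unshelve. all: by end_near. Qed.

End OrthogonalPolynomials.

(** * The Lommel type polynomials *)

Section Quotient.
Variables (R : realType) (a b : nat -> R).

(** Each coefficient of a quotient depends on all earlier ones, so the recursion carries the whole
    list. *)
Fixpoint quotient_list n : seq R :=
  if n is n'.+1 then
    let l := quotient_list n' in
    rcons l ((a n' - \sum_(0 <= i < n') l`_i * b (n' - i)%N) / b 0%N)
  else [::].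

Definition series_quotient n := (quotient_list n.+1)`_n.

Lemma size_quotient_list n : size (quotient_list n) = n.
Proof. by elim: n => //= n IH; rewrite size_rcons IH. Qed.

Lemma nth_quotient_list n i : (i < n)%N ->
  (quotient_list n)`_i = series_quotient i.
Proof.
elim: n => // n IH; rewrite ltnS leq_eqVlt => /predU1P[-> //|ilt].
by rewrite /= nth_rcons size_quotient_list ilt IH.
Qed.

Lemma series_quotientP r : b 0%N != 0 ->
  \sum_(0 <= i < r.+1) series_quotient i * b (r - i)%N = a r.
Proof.
move=> b0; rewrite big_nat_recr//= subnn /series_quotient /=.
rewrite nth_rcons size_quotient_list ltnn eqxx divfK// addrC.
rewrite -[RHS]addr0 -addrA; congr (_ + _); apply/eqP.
rewrite addrC subr_eq0; apply/eqP; apply: eq_big_nat => i /andP[_ ir].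
by rewrite nth_quotient_list.
Qed.

End Quotient.

Section Spread.
Variable R : realType.
Implicit Type c : nat -> R.

(** These are the coefficients of the series [c] taken at the square of the variable; used as
    moments, they define a functional that kills odd powers. *)
Definition spread c i : R := if odd i then 0 else c i./2.

Lemma spread_double c i : spread c i.*2 = c i.
Proof. by rewrite /spread odd_double doubleK. Qed.

Lemma spread_doubleS c i : spread c i.*2.+1 = 0.
Proof. by rewrite /spread /= odd_double. Qed.

Lemma sum_spread c r :
  \sum_(0 <= i < r.*2.+1) spread c i = \sum_(0 <= i < r.+1) c i.
Proof.
elim: r => [|r IH]; first by rewrite !big_nat1.
rewrite [RHS]big_nat_recr// -IH doubleS big_nat_recr// -doubleS spread_double.
by rewrite big_nat_recr// spread_doubleS; congr (_ + _); rewrite -[RHS]addr0.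
Qed.

Lemma spread_conv c d r :
  \sum_(0 <= i < r.+1) spread c i * spread d (r - i)%N =
  spread (fun k => \sum_(0 <= i < k.+1) c i * d (k - i)%N) r.
Proof.
rewrite [RHS]/spread; case: ifPn => [odr|].
  apply: big1_seq => i /=; rewrite mem_index_iota ltnS => /andP[_ ir].
  rewrite /spread; case: ifPn => [_|ei]; first by rewrite mul0r.
  by rewrite oddB// odr (negPf ei) mulr0.
move=> er; rewrite -[in LHS](odd_double_half r) (negPf er) add0n -[RHS]sum_spread.
apply: eq_big_nat => i /andP[_ ir]; rewrite [RHS]/spread.
case: ifPn => oi; first by rewrite /spread oi mul0r.
have -> : i = i./2.*2 by rewrite -[LHS]odd_double_half (negPf oi).
by rewrite -doubleB !spread_double doubleK.
Qed.

End Spread.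

Section Lommel.
Variables (R : realType) (nu : R).
Hypothesis nu_gt0 : 0 < nu.

(** The recurrence is that of the Bessel functions in the variable [2 / z]. The start
    [(nu / 2) *: 'X] encodes [J_(nu+1) z = nu / z * J_nu z], which holds where [J_nu' z = 0]. *)
Fixpoint lommel n : {poly R} :=
  match n with
  | 0 => 1
  | 1 => (nu / 2) *: 'X
  | (n'.+1 as k).+1 => (nu + k%:R) *: ('X * lommel k) - lommel n'
  end.

Lemma lommelSS n :
  lommel n.+2 = (nu + n.+1%:R) *: ('X * lommel n.+1) - lommel n.
Proof. by []. Qed.

Lemma horner_lommelSS n y : (lommel n.+2).[y] =
  (nu + n.+1%:R) * y * (lommel n.+1).[y] - (lommel n).[y].
Proof.
by rewrite lommelSS hornerD hornerN hornerZ hornerM hornerX mulrA.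
Qed.

Lemma horner_lommel0 y : (lommel 0).[y] = 1.
Proof. by rewrite hornerC. Qed.

Lemma horner_lommel1 y : (lommel 1).[y] = nu / 2 * y.
Proof. by rewrite hornerZ hornerX. Qed.

Lemma horner_lommelN n y : (lommel n).[- y] = (-1) ^+ n * (lommel n).[y].
Proof.
suff: (lommel n).[- y] = (-1) ^+ n * (lommel n).[y] /\
  (lommel n.+1).[- y] = (-1) ^+ n.+1 * (lommel n.+1).[y] by case.
elim: n => [|n [IH1 IH2]].
  by rewrite !horner_lommel0 !horner_lommel1 expr0 expr1; split; ring.
by split=> //; rewrite !horner_lommelSS IH1 IH2 !exprS; ring.
Qed.

Lemma nu_natS_neq0 n : nu + n.+1%:R != 0.
Proof. by rewrite lt0r_neq0// addr_gt0. Qed.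

(** The ratio [Gamma (nu + n + 1) / Gamma (nu + 1)], a rising factorial of [nu + 1]. *)
Definition poch n : R := \prod_(l < n) (nu + l.+1%:R).

Lemma pochS n : poch n.+1 = poch n * (nu + n.+1%:R).
Proof. by rewrite /poch big_ord_recr. Qed.

Lemma poch0 : poch 0 = 1. Proof. by rewrite /poch big_ord0. Qed.

Lemma poch_gt0 n : 0 < poch n.
Proof. by apply: prodr_gt0 => l _; rewrite addr_gt0. Qed.

Definition lommel_lead n : R := if n is n'.+1 then nu / 2 * poch n' else 1.

Lemma size_lommel_lead n :
  (size (lommel n) = n.+1) /\ (lommel n)`_n = lommel_lead n.
Proof.
suff: forall n, ((size (lommel n) <= n.+1)%N /\ (lommel n)`_n = lommel_lead n) /\
   ((size (lommel n.+1) <= n.+2)%N /\ (lommel n.+1)`_n.+1 = lommel_lead n.+1).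
  move=> /(_ n)[[sn cn] _]; split=> //; apply/eqP; rewrite eqn_leq sn ltnNge /=.
  apply/negP => /leq_sizeP/(_ n (leqnn _)); rewrite cn; apply/eqP/lt0r_neq0.
  by case: (n) => [|k] /=; rewrite ?ltr01// mulr_gt0 ?poch_gt0// divr_gt0.
elim=> [|k [[s0 c0] [s1 c1]]].
  rewrite /= size_poly1 coefC coefZ coefX poch0; split=> //; split=> //.
  by rewrite (leq_trans (size_scale_leq _ _))// size_polyX.
split; first by split.
split.
  rewrite lommelSS; apply: leq_trans (size_polyD _ _) _.
  have s0' : (size (lommel k) <= k.+3)%N by lia.
  rewrite geq_max size_polyN s0' andbT.
  apply: leq_trans (size_scale_leq _ _) _.
  apply: leq_trans (size_polyMleq _ _) _; rewrite size_polyX /=.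
  by rewrite ltnS.
rewrite lommelSS coefB coefZ coefXM c1 (nth_default _ (leq_trans s0 _)) ?subr0//.
by rewrite /= pochS; ring.
Qed.

Lemma size_lommel n : size (lommel n) = n.+1.
Proof. by case: (size_lommel_lead n). Qed.

(* [J_(nu + n) z] is [(z / 2) `^ (nu + n) / Gamma (nu + 1)] times the sum of this
   power series at [z ^+ 2 / 4]. *)
Definition fcoef n i : R := (-1) ^+ i / (i`!%:R * poch (n + i)).

(* the same for [z * J_nu' z], with the prefactor [(z / 2) `^ nu / Gamma (nu + 1)] *)
Definition bcoef i : R := (nu + 2 * i%:R) * fcoef 0 i.

Lemma fcoef_rec n i : fcoef n.+2 i =
  (nu + n.+1%:R) * fcoef n.+1 i.+1 - fcoef n i.+1.
Proof.
rewrite /fcoef !addSn !addnS !pochS exprS factS natrM -!natr1 !natrD.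
have p := lt0r_neq0 (poch_gt0 (n + i)).
have fi : (i`!)%:R != 0 :> R by rewrite pnatr_eq0 -lt0n fact_gt0.
by field; rewrite p fi -natrD !natr1 pnatr_eq0 !nu_natS_neq0.
Qed.

Lemma fcoef_rec0 n : fcoef n 0 = (nu + n.+1%:R) * fcoef n.+1 0.
Proof.
rewrite /fcoef !addn0 !pochS expr0 fact0.
have p := lt0r_neq0 (poch_gt0 n).
by field; rewrite p ?nat1r ?natr1 nu_natS_neq0.
Qed.

(** Coefficient form of the fact that the derivative of [psum (fcoef 0)] is [- psum (fcoef 1)]. *)
Lemma fcoef1 i : fcoef 1 i = - (i.+1%:R * fcoef 0 i.+1).
Proof.
rewrite /fcoef !addSn !add0n factS exprS natrM.
have p := lt0r_neq0 (poch_gt0 i.+1).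
have fi : (i`!)%:R != 0 :> R by rewrite pnatr_eq0 -lt0n fact_gt0.
by field; rewrite p fi ?nat1r ?natr1 pnatr_eq0.
Qed.

Lemma bcoef0 : bcoef 0 = nu.
Proof. by rewrite /bcoef /fcoef poch0 fact0 expr0; field. Qed.

Definition lmom := spread (series_quotient (fcoef 0) bcoef).

(* the coefficient of [x ^+ i] in [x ^+ n * psum (fcoef n) (x ^+ 2)] *)
Definition shifted n i : R := if (n <= i)%N then spread (fcoef n) (i - n) else 0.

Lemma shifted_rec n i :
  shifted n.+2 i = (nu + n.+1%:R) * shifted n.+1 i.+1 - shifted n i.
Proof.
rewrite /shifted ltnS; case: (ltngtP i n) => [lt|gt|->].
- by rewrite ltnNge (leq_trans (ltnW lt) (leqnSn n)) mulr0 subr0.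
- rewrite subSS; have [->|n2] := eqVneq i n.+1.
    by rewrite ltnn subSn// subnn /spread /= mulr0 subr0.
  have [k ->] : exists k, i = (n.+2 + k)%N by exists (i - n.+2)%N; lia.
  have -> : (n.+2 + k - n = k.+2)%N by lia.
  rewrite addKn leq_addr /spread /= negbK.
  by case: ifP => _; [rewrite mulr0 subr0|exact: fcoef_rec].
- by rewrite ltnNge leqnSn /= subSS subnn /spread /= (fcoef_rec0 n) subrr.
Qed.

Local Notation L := (momfun lmom).

(** In generating functions: the moment series of [lommel n], multiplied by the denominator of the
    quotient that defines [L], is the series of [J_(nu+n)]. Both sides obey the same three-term
    recurrence in [n], and the starting cases are the definition of the quotient and [fcoef1]. *)
Lemma momfun_shift_lommel n i :
  \sum_(0 <= k < i.+1) spread bcoef k * L ('X^(i - k) * lommel n) = shifted n i.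
Proof.
suff: forall n,
  (forall i, \sum_(0 <= k < i.+1) spread bcoef k * L ('X^(i - k) * lommel n)
     = shifted n i) /\
  (forall i, \sum_(0 <= k < i.+1) spread bcoef k * L ('X^(i - k) * lommel n.+1)
     = shifted n.+1 i).
  by move=> /(_ n)[H _].
have nu_neq0 := lt0r_neq0 nu_gt0.
have base k : \sum_(0 <= j < k.+1) spread bcoef j * L ('X^(k - j) * lommel 0) = shifted 0 k.
  rewrite /shifted leq0n subn0.
  rewrite (_ : spread (fcoef 0) = spread (fun r =>
      \sum_(0 <= i < r.+1) bcoef i * series_quotient (fcoef 0) bcoef (r - i)%N)).
    rewrite -spread_conv; apply: eq_bigr => j _.
    by rewrite mulr1 momfunXn.
  congr spread; apply/funext => r.
  rewrite -[LHS](@series_quotientP _ _ bcoef) ?bcoef0//.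
  rewrite big_nat_rev; apply: eq_big_nat => j /andP[_ jr].
  by rewrite add0n subSS mulrC subKn.
(* Absorbing a factor ['X] shifts the moment series by one place, at the cost of its constant term
   [L (lommel n')]. *)
have splitoff n' k : \sum_(0 <= j < k.+1) spread bcoef j * L ('X^((k - j).+1) * lommel n') =
    \sum_(0 <= j < k.+2) spread bcoef j * L ('X^(k.+1 - j) * lommel n') -
    spread bcoef k.+1 * L (lommel n').
  rewrite [X in _ = X - _]big_nat_recr//= subnn expr0 mul1r addrK.
  by apply: eq_big_nat => j /andP[_ jk]; rewrite subSn.
elim=> [|n' [IH0 IH1]].
  split=> // k; have L1 : L (lommel 0) = nu^-1.
    rewrite -[lommel 0]/('X^0) momfunXn /lmom /spread /= /series_quotient /=.
    by rewrite big_nil subr0 bcoef0 /fcoef poch0 fact0 expr0 !mulr1 divr1 mul1r.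
  transitivity (nu / 2 * \sum_(0 <= j < k.+1) spread bcoef j * L ('X^((k - j).+1) * lommel 0)).
    rewrite mulr_sumr; apply: eq_bigr => j _.
    by rewrite -scalerAr momfunZ -exprSr mulr1; ring.
  rewrite splitoff base L1 /shifted leq0n subn0.
  case: k => [|k]; first by rewrite /spread /= mul0r subrr mulr0.
  rewrite subn1 /spread /= negbK; case: ifP => _; first by rewrite mul0r subrr mulr0.
  by rewrite fcoef1 /bcoef; field.
split=> // k.
(* The series of [lommel n'.+1] has no constant term, so nothing is lost in the shift. *)
have L0 : L (lommel n'.+1) = 0.
  have := IH1 0; rewrite big_nat1 mul1r /shifted /= => /eqP.
  by rewrite -{1}[0%N]/(0.*2)%N spread_double bcoef0 mulf_eq0 (negPf nu_neq0) => /eqP.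
rewrite shifted_rec -IH0 -IH1.
transitivity ((nu + n'.+1%:R) *
     \sum_(0 <= j < k.+1) spread bcoef j * L ('X^((k - j).+1) * lommel n'.+1)
   - \sum_(0 <= j < k.+1) spread bcoef j * L ('X^(k - j) * lommel n')).
  rewrite mulr_sumr -sumrB; apply: eq_bigr => j _.
  rewrite lommelSS mulrBr momfunB -scalerAr momfunZ ['X^_ * ('X * _)]mulrA -exprSr; ring.
by rewrite splitoff L0 mulr0 subr0.
Qed.

(** [shifted n] starts in degree [n], and the identity is a triangular system with diagonal entry
    [bcoef 0 = nu], which is nonzero. *)
Lemma momfun_lommel_low n i : (i < n)%N -> L ('X^i * lommel n) = 0.
Proof.
have nu_neq0 := lt0r_neq0 nu_gt0.
elim/ltn_ind: i => i IH ilt.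
have := momfun_shift_lommel n i.
rewrite big_nat_recl// subn0 /shifted leqNgt ilt /= big1_seq ?addr0.
  by move/eqP; rewrite -{1}[0%N]/(0.*2)%N spread_double bcoef0 mulf_eq0 (negPf nu_neq0) => /eqP.
move=> j /=; rewrite mem_index_iota => /andP[_ ji].
by rewrite IH ?mulr0//; lia.
Qed.

Lemma momfun_lommel_lead n : L ('X^n * lommel n) = (nu * poch n)^-1.
Proof.
have nu_neq0 := lt0r_neq0 nu_gt0.
have := momfun_shift_lommel n n.
rewrite big_nat_recl// subn0 /shifted leqnn subnn big1_seq ?addr0.
  rewrite -{1}[0%N]/(0.*2)%N spread_double bcoef0 /spread /= /fcoef addn0 expr0 fact0 !mul1r.
  by move=> H; rewrite invfM -H mulKf.
move=> j /=; rewrite mem_index_iota => /andP[_ ji].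
by rewrite momfun_lommel_low ?mulr0//; lia.
Qed.

Lemma momfun_lommel_small n (f : {poly R}) : (size f <= n)%N ->
  L (f * lommel n) = 0.
Proof.
move=> fn; rewrite -[f]coefK poly_def mulr_suml momfun_sum big1// => i _.
rewrite -scalerAl momfunZ momfun_lommel_low ?mulr0//.
exact: leq_trans (ltn_ord i) fn.
Qed.

(** The factor 1/2 of [lommel 1] enters every leading coefficient except that of [lommel 0]; hence
    the separate case. *)
Definition lommel_norm n : R := if n is n'.+1 then (2 * (nu + n%:R))^-1 else nu^-1.

Lemma lommel_norm_gt0 n : 0 < lommel_norm n.
Proof.
by case: n => [|n]; rewrite /= invr_gt0// mulr_gt0// addr_gt0.
Qed.

Lemma lommel_ortho n k : L (lommel n * lommel k) = (n == k)%:R * lommel_norm n.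
Proof.
wlog nk : n k / (n <= k)%N.
  move=> H; have [/H//|/ltnW/H] := leqP n k.
  by rewrite mulrC eq_sym => ->; case: eqVneq => [->|]; rewrite ?mul0r.
move: nk; rewrite leq_eqVlt => /predU1P[<-|nk]; last first.
  by rewrite momfun_lommel_small ?size_lommel// ltn_eqF// mul0r.
rewrite eqxx mul1r; have [sn cn] := size_lommel_lead n.
have -> : lommel n * lommel n = (lommel n - lommel_lead n *: 'X^n) * lommel n +
    lommel_lead n *: ('X^n * lommel n).
  by rewrite mulrBl -scalerAl subrK.
rewrite momfunD momfunZ momfun_lommel_lead momfun_lommel_small ?add0r.
  case: n {sn cn} => [|n] /=; first by rewrite poch0 mulr1 mul1r.
  rewrite pochS; have := lt0r_neq0 (poch_gt0 n); have := lt0r_neq0 nu_gt0.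
  have : nu + n.+1%:R != 0 by rewrite lt0r_neq0// addr_gt0.
  by move=> h1 h2 h3; field; rewrite ?nat1r ?natr1 h1 h2 h3.
apply/leq_sizeP => i; rewrite leq_eqVlt => /predU1P[<-|ni].
  by rewrite coefB coefZ coefXn eqxx mulr1 cn subrr.
rewrite coefB coefZ coefXn gtn_eqF// mulr0 subr0 nth_default//.
by rewrite sn.
Qed.

End Lommel.

(** * Series with factorially decreasing coefficients *)

Section ExponentialBounds.
Variable R : realType.
Implicit Types (c : nat -> R) (D v : R).
Local Open Scope classical_set_scope.

Lemma cvg_fromS (u w : nat -> R) (l : R) : (forall n, u n.+1 = w n) ->
  w @ \oo --> l -> u @ \oo --> l.
Proof. by move=> /funext uw wl; rewrite -cvg_shiftS uw. Qed.

Lemma sum_exp_coeff_le v N : 0 <= v ->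
  \sum_(0 <= i < N) v ^+ i / i`!%:R <= expR v.
Proof.
move=> v0; have := @nondecreasing_cvgn_le R (series (exp_coeff v)) _ _ N.
apply; last exact: is_cvg_series_exp_coeff.
apply/nondecreasing_seqP => n; rewrite /series /= big_nat_recr//= lerDl.
by rewrite divr_ge0// exprn_ge0.
Qed.

Lemma entire_factorial c D : (forall i, `|c i| <= D / i`!%:R) -> entire c.
Proof.
move=> cD C C0; exists (D * expR C) => i.
have D0 : 0 <= D by have := le_trans (normr_ge0 _) (cD 0%N); rewrite fact0 divr1.
apply: le_trans (ler_wpM2r (exprn_ge0 _ (ltW C0)) (cD i)) _.
rewrite -mulrA ler_wpM2l//; apply: le_trans (sum_exp_coeff_le i.+1 (ltW C0)).
rewrite big_nat_recr//= [_^-1 * _]mulrC lerDr sumr_ge0// => k _.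
by rewrite divr_ge0// exprn_ge0// ltW.
Qed.

Lemma psum_factorial_le c D v : (forall i, `|c i| <= D / i`!%:R) -> 0 <= v ->
  `|psum c v| <= D * expR v.
Proof.
move=> cD v0; have ec := entire_factorial cD.
have D0 : 0 <= D by have := le_trans (normr_ge0 _) (cD 0%N); rewrite fact0 divr1.
have cv : (fun N => `|pseries c v N|) @ \oo --> `|psum c v|.
  by apply: cvg_norm; exact: psum_cvg.
rewrite -(cvg_lim _ cv)//; apply: limr_le; first exact: cvgP cv.
near=> N; apply: le_trans (ler_norm_sum _ _ _) _.
apply: (@le_trans _ _ (D * \sum_(0 <= i < N) v ^+ i / i`!%:R)).
  rewrite mulr_sumr; apply: ler_sum => i _.
  rewrite normrM normrX (ger0_norm v0) mulrCA mulrC.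
  by rewrite ler_wpM2l// exprn_ge0.
by rewrite ler_wpM2l// sum_exp_coeff_le.
Unshelve. all: by end_near. Qed.

Lemma entire_shift c : entire c -> entire (fun i => c i.+1).
Proof.
move=> ec C C0; have [S cS] := ec _ C0; exists (S / C) => i.
by rewrite ler_pdivlMr// -mulrA -exprSr.
Qed.

Lemma psum_shift c v : entire c -> psum c v = c 0%N + v * psum (fun i => c i.+1) v.
Proof.
move=> ec; apply: psum_unique; rewrite -cvg_shiftS.
rewrite (_ : [sequence _]_n = fun N => c 0%N + v * pseries (fun i => c i.+1) v N).
  apply: cvgD; first exact: cvg_cst.
  by apply: cvgMr; apply: psum_cvg; exact: entire_shift.
apply/funext => N; rewrite /pseries /series /= big_nat_recl//= expr0 mulr1.
by rewrite mulr_sumr; congr (_ + _); apply: eq_bigr => i _; rewrite exprS; ring.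
Qed.

Lemma natmul_exp_coeff_cvg0 v :
  (fun n => n%:R * (v ^+ n / n`!%:R)) @ \oo --> (0 : R).
Proof.
apply: (@cvg_fromS _ (fun n => v * exp_coeff v n)); last first.
  by rewrite -[X in _ --> X](mulr0 v); apply: cvgMr; exact: cvg_exp_coeff.
move=> n; rewrite /exp_coeff /= factS natrM exprS.
have fi : (n`!)%:R != 0 :> R by rewrite pnatr_eq0 -lt0n fact_gt0.
by field; rewrite fi ?nat1r ?natr1 pnatr_eq0.
Qed.

End ExponentialBounds.

(** * Limits of the kernels of the Lommel type polynomials *)

Section LommelKernel.
Variables (R : realType) (nu : R).
Hypothesis nu_gt0 : 0 < nu.
Local Open Scope classical_set_scope.
Local Notation kernel := (ckernel (lommel nu) (lommel_norm nu)).
Local Notation r n u := (lommel nu n).[u].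

Lemma kernelS N u v : (kernel N.+2 v).[u] = (kernel N.+1 v).[u] +
  2 * (nu + N.+1%:R) * r N.+1 u * r N.+1 v.
Proof.
by rewrite !ckernelE [LHS]big_ord_recr /= invrK; congr (_ + _); ring.
Qed.

Lemma kernel1 u v : (kernel 1 v).[u] = nu.
Proof. by rewrite ckernelE big_ord1 !horner_lommel0 /= invrK !mul1r. Qed.

Lemma christoffel_darboux N u v : (u - v) * (kernel N.+1 v).[u] =
  2 * (r N.+1 u * r N v - r N u * r N.+1 v).
Proof.
elim: N => [|N IH].
  by rewrite kernel1 !horner_lommel0 !horner_lommel1; field.
rewrite kernelS mulrDr IH !horner_lommelSS; ring.
Qed.

Definition lommel_form u n : R := 2 / u ^+ 2 * (r n u ^+ 2 + r n.+1 u ^+ 2) -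
  (nu + n%:R) * (2 / u) * r n u * r n.+1 u.

(* Telescoping: [lommel_form u n - lommel_form u n.+1] is
   [2 / u * r n u * r n.+1 u] by the recurrence. *)
Lemma kernel_diag N u : u != 0 -> (kernel N.+1 u).[u] =
  4 / u ^+ 2 - nu ^+ 2 - (lommel_form u N + lommel_form u N.+1).
Proof.
move=> u0; elim: N => [|N IH].
  rewrite kernel1 /lommel_form !horner_lommelSS !horner_lommel0 !horner_lommel1.
  by field.
rewrite kernelS IH /lommel_form !horner_lommelSS -!natr1; field.
exact: u0.
Qed.

(** The factor [n] is what makes the cross term of [lommel_form], which grows linearly in [n], tend
    to 0. *)
Definition decays u := (fun n => n%:R * r n u) @ \oo --> (0 : R).

Lemma decays_cvg0 u : decays u -> (fun n => r n u) @ \oo --> (0 : R).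
Proof.
move=> du; apply/norm_cvg0P.
have du' : (fun n => `|n%:R * r n u|) @ \oo --> (0 : R).
  by rewrite -(normr0 R); exact: cvg_norm.
apply: (@squeeze_cvgr _ _ _ _ (fun=> 0) _ _ _ _ _ du'); last exact: cvg_cst.
near=> n; rewrite normr_ge0 normrM -[leLHS]mul1r ler_wpM2r// normr_nat ler1n.
by near: n; exists 1%N.
Unshelve. all: by end_near. Qed.

Lemma decays_form u : decays u -> lommel_form u @ \oo --> (0 : R).
Proof.
move=> du; have d0 := decays_cvg0 du.
have d1 : (fun n => r n.+1 u) @ \oo --> (0 : R).
  by rewrite (cvg_shiftS (fun n => r n u)).
rewrite -[X in _ --> X](_ : 2 / u ^+ 2 * (0 * 0 + 0 * 0) -
  (nu * (2 / u) * (0 * 0) + 2 / u * (0 * 0)) = 0); last by ring.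
rewrite (_ : lommel_form u = fun n => 2 / u ^+ 2 * (r n u * r n u + r n.+1 u * r n.+1 u)
  - (nu * (2 / u) * (r n u * r n.+1 u) + 2 / u * (n%:R * r n u * r n.+1 u))); last first.
  by apply/funext => n; rewrite /lommel_form; ring.
apply: cvgB; first by apply: cvgMr; apply: cvgD; exact: cvgM.
by apply: cvgD; apply: cvgMr; exact: cvgM.
Qed.

Lemma kernel_diag_cvg u : u != 0 -> decays u ->
  (fun N => (kernel N u).[u]) @ \oo --> 4 / u ^+ 2 - nu ^+ 2.
Proof.
move=> u0 du; have f0 := decays_form du.
apply: cvg_fromS => [N|]; first exact: kernel_diag.
rewrite -[X in _ --> X]subr0 -[X in _ --> _ - X](addr0 0).
by apply: cvgB; [exact: cvg_cst|apply: cvgD => //; rewrite cvg_shiftS].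
Qed.

Lemma kernel_offdiag_cvg u v : u != v -> decays u -> decays v ->
  (fun N => (kernel N v).[u]) @ \oo --> (0 : R).
Proof.
rewrite -subr_eq0 => uv /decays_cvg0 du /decays_cvg0 dv.
apply: (@cvg_fromS _ _ (fun n => (u - v)^-1 * (2 * (r n.+1 u * r n v - r n u * r n.+1 v)))).
  by move=> N; rewrite -christoffel_darboux mulKf.
rewrite -[X in _ --> X](_ : (u - v)^-1 * (2 * (0 * 0 - 0 * 0)) = 0); last by ring.
by do 2!apply: cvgMr; apply: cvgB; apply: cvgM => //; rewrite (cvg_shiftS (fun n => r n _)).
Qed.

Let term_ge0 N (x : R) : 0 <= 2 * (nu + N.+1%:R) * x * x.
Proof.
have : 0 <= nu + N.+1%:R by rewrite addr_ge0// ltW.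
by move=> ?; rewrite -mulrA -expr2 mulr_ge0 ?sqr_ge0// mulr_ge0.
Qed.

Lemma kernel_diag_ge N u : nu <= (kernel N.+1 u).[u].
Proof.
elim: N => [|N IH]; first by rewrite kernel1.
rewrite kernelS; apply: le_trans IH _; rewrite lerDl.
exact: term_ge0.
Qed.

Lemma lommel0_sqr n : r n.*2 0 ^+ 2 = 1.
Proof.
elim: n => [|n IH]; first by rewrite horner_lommel0 expr1n.
by rewrite doubleS horner_lommelSS mulr0 mul0r sub0r sqrrN.
Qed.

(** At the origin the polynomials of even index take the values 1 and -1, so each contributes at
    least [nu] and the kernel diverges. This will exclude a mass at the origin. *)
Lemma kernel0_ge N : N%:R * nu <= (kernel N.*2.+1 0).[0].
Proof.
elim: N => [|N IH]; first by rewrite mul0r kernel1 ltW.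
rewrite doubleS 2!kernelS -[X in _ + X]mulrA -expr2 -doubleS lommel0_sqr mulr1.
rewrite -natr1 mulrDl mul1r -addrA lerD//.
rewrite ler_wpDl//.
by rewrite mulrDr ler_wpDr ?mulr_ge0// ler_peMl ?ler1n// ltW.
Qed.

End LommelKernel.

(** * Values at the zeros of the derivative of the Bessel function *)

Section BesselSeries.
Variables (R : realType) (nu : R).
Hypothesis nu_gt0 : 0 < nu.
Local Open Scope classical_set_scope.
Local Notation F n s := (psum (fcoef nu n) s).
Local Notation poch := (poch nu).

Lemma poch_addS n i : poch n * n.+1%:R <= poch (n + i.+1).
Proof.
have nuS k : k.+1%:R <= nu + k.+1%:R by rewrite lerDr ltW.
elim: i => [|i IH].
  by rewrite addn1 pochS ler_wpM2l// ltW// poch_gt0.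
rewrite addnS pochS -[leLHS]mulr1; apply: ler_pM => //.
  by rewrite mulr_ge0// ltW// poch_gt0.
by apply: le_trans (nuS _); rewrite ler1n.
Qed.

Lemma poch_ge_fact n : n`!%:R <= poch n.
Proof.
elim: n => [|n IH]; first by rewrite poch0.
rewrite factS mulnC natrM pochS; apply: ler_pM => //.
by rewrite lerDr ltW.
Qed.

Lemma fcoef_le n i : `|fcoef nu n i| <= n`!%:R^-1 / i`!%:R.
Proof.
have fi k : 0 < k`!%:R :> R by rewrite ltr0n fact_gt0.
rewrite /fcoef normrM normrX normrN1 expr1n mul1r normfV.
rewrite gtr0_norm ?mulr_gt0 ?poch_gt0// -invfM lef_pV2 ?posrE ?mulr_gt0 ?poch_gt0//.
rewrite mulrC ler_wpM2l//; apply: (@le_trans _ _ (poch n)); first exact: poch_ge_fact.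
case: i => [|i]; first by rewrite addn0.
apply: le_trans (poch_addS n i); rewrite ler_peMr ?ler1n// ltW// poch_gt0//.
Qed.

Lemma entire_fcoef n : entire (fcoef nu n).
Proof. exact: entire_factorial (fcoef_le n). Qed.

Lemma entire_bcoef : entire (bcoef nu).
Proof.
have -> : bcoef nu = fun i => nu * fcoef nu 0 i + 2 * (i%:R * fcoef nu 0 i).
  by apply/funext => i; rewrite /bcoef; ring.
have e := entire_fcoef 0.
by apply: entireD; apply: entireZ => //; exact: entire_natmul.
Qed.

Lemma psum_bcoef s : psum (bcoef nu) s =
  nu * F 0 s + 2 * psum (fun i => i%:R * fcoef nu 0 i) s.
Proof.
have e := entire_fcoef 0; have e' := entire_natmul e.
rewrite -!psumZ// -psumD; [|exact: entireZ|exact: entireZ].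
by congr psum; apply/funext => i; rewrite /bcoef; ring.
Qed.

Lemma psum_natmul_fcoef s :
  psum (fun i => i%:R * fcoef nu 0 i) s = - s * F 1 s.
Proof.
rewrite psum_shift ?mul0r ?add0r; last exact/entire_natmul/entire_fcoef.
rewrite mulNr -mulrN; congr (_ * _); rewrite -mulN1r -psumZ; last exact: entire_fcoef.
by congr psum; apply/funext => i; rewrite fcoef1//; ring.
Qed.

Lemma psum_fcoef_rec n s :
  s * F n.+2 s = (nu + n.+1%:R) * F n.+1 s - F n s.
Proof.
have e k := entire_fcoef k; have es k := entire_shift (e k).
rewrite (psum_shift s (e n)) (psum_shift s (e n.+1)) (fcoef_rec0 nu_gt0 n).
have -> : F n.+2 s = (nu + n.+1%:R) * psum (fun i => fcoef nu n.+1 i.+1) s -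
    psum (fun i => fcoef nu n i.+1) s.
  rewrite -psumZ// -mulN1r -psumZ// -psumD; [|exact: entireZ|exact: entireZ].
  by congr psum; apply/funext => i; rewrite fcoef_rec//; ring.
ring.
Qed.

Lemma psum_fcoef_exp n s : 0 <= s -> `|F n s| <= n`!%:R^-1 * expR s.
Proof. by move=> s0; apply: psum_factorial_le => // i; exact: fcoef_le. Qed.

(** The constant coefficient dominates for large [n], with relative error at most
    [s * expR s / n.+1]. *)
Lemma psum_fcoef_tail n s : 0 <= s ->
  `|F n s - (poch n)^-1| <= s * ((poch n)^-1 / n.+1%:R * expR s).
Proof.
move=> s0; have -> : (poch n)^-1 = fcoef nu n 0.
  by rewrite /fcoef addn0 expr0 fact0 !mul1r.
rewrite (psum_shift s (entire_fcoef n)) addrAC subrr add0r.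
rewrite normrM (ger0_norm s0) ler_wpM2l//.
have -> : fcoef nu n 0 = (poch n)^-1 by rewrite /fcoef addn0 expr0 fact0 !mul1r.
apply: psum_factorial_le => // i.
have fi k : 0 < k`!%:R :> R by rewrite ltr0n fact_gt0.
rewrite /fcoef normrM normrX normrN1 expr1n mul1r normfV.
rewrite gtr0_norm ?mulr_gt0 ?poch_gt0// -!invfM lef_pV2 ?posrE ?mulr_gt0 ?poch_gt0//.
rewrite mulrC; apply: ler_pM => //; last exact: poch_addS.
  by rewrite mulr_ge0// ltW// poch_gt0.
by rewrite ler_nat factS leq_pmull.
Qed.

Section Zero.
Variables (s : R).
Hypotheses (s_gt0 : 0 < s) (s_zero : psum (bcoef nu) s = 0).

Let s_ge0 : 0 <= s. Proof. exact: ltW. Qed.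

(** This is [J_(nu+1) z = nu / z * J_nu z], obtained from
    [z J_nu' z = nu * J_nu z - z * J_(nu+1) z]. *)
Lemma zero_rel : s * F 1 s = nu / 2 * F 0 s.
Proof. by have := psum_bcoef s; rewrite s_zero psum_natmul_fcoef => H; lra. Qed.

(* Otherwise all [F n s] vanish by the recurrence, although
   [poch n * F n s] tends to 1. *)
Lemma psum_fcoef_neq0 : F 0 s != 0.
Proof.
apply/eqP => F0.
have Fn n : F n s = 0.
  suff: F n s = 0 /\ F n.+1 s = 0 by case.
  elim: n => [|n [IH1 IH2]].
    split=> //; apply/eqP; have/eqP := zero_rel.
    by rewrite F0 mulr0 mulf_eq0 gt_eqF.
  split=> //; apply/eqP; have/eqP := psum_fcoef_rec n s.
  by rewrite IH1 IH2 mulr0 subr0 mulf_eq0 gt_eqF.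
have bound n : n.+1%:R <= s * expR s.
  have := psum_fcoef_tail n s_ge0; have p := poch_gt0 nu_gt0 n.
  rewrite Fn sub0r normrN gtr0_norm ?invr_gt0//.
  rewrite (_ : s * (_ * _) = (poch n)^-1 * (s * expR s / n.+1%:R)); last first.
    by rewrite -!mulrA [LHS]mulrCA [_^-1 * expR s]mulrC.
  by rewrite -[leLHS]mulr1 ler_pM2l ?invr_gt0// ler_pdivlMr// mul1r.
have := bound (Num.bound (s * expR s)); apply/negP; rewrite -ltNge.
apply: lt_le_trans (archi_boundP _) _; first by rewrite mulr_ge0// expR_ge0.
by rewrite ler_nat.
Qed.

(* The value of the derivative of [psum bcoef] at its zero comes from Bessel's
   equation, in the form [i * (nu + i) * fcoef 0 i = - fcoef 0 i.-1]. *)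
Lemma zero_residue : 4 * s - nu ^+ 2 != 0 ->
  F 0 s = 2 / (4 * s - nu ^+ 2) * psum (deflate s (bcoef nu)) s.
Proof.
move=> d0; rewrite psum_deflate_root//; last exact: entire_bcoef.
have e0 := entire_fcoef 0; have e1 := entire_natmul e0; have e2 := entire_natmul e1.
have -> : psum (fun i => i%:R * bcoef nu i) s =
    2 * psum (fun i => i%:R * (nu + i%:R) * fcoef nu 0 i) s -
    nu * psum (fun i => i%:R * fcoef nu 0 i) s.
  have eg : entire (fun i => i%:R * (nu + i%:R) * fcoef nu 0 i).
    rewrite (_ : (fun _ => _) = fun i => nu * (i%:R * fcoef nu 0 i) +
       i%:R * (i%:R * fcoef nu 0 i)); last by apply/funext => i; ring.
    by apply: entireD => //; exact: entireZ.
  rewrite -psumZ// -mulNr -psumZ// -psumD; [|exact: entireZ|exact: entireZ].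
  by congr psum; apply/funext => i; rewrite /bcoef; ring.
have -> : psum (fun i => i%:R * (nu + i%:R) * fcoef nu 0 i) s = - (s * F 0 s).
  rewrite psum_shift ?mul0r ?add0r.
    rewrite -mulrN; congr (_ * _); rewrite -mulN1r -psumZ//.
    congr psum; apply/funext => i.
    rewrite /fcoef !add0n pochS factS exprS natrM.
    have p := lt0r_neq0 (poch_gt0 nu_gt0 i).
    have fi : (i`!)%:R != 0 :> R by rewrite pnatr_eq0 -lt0n fact_gt0.
    field; rewrite p fi ?nat1r ?natr1 pnatr_eq0 nu_natS_neq0//.
  rewrite (_ : (fun _ => _) = fun i => nu * (i%:R * fcoef nu 0 i) +
     i%:R * (i%:R * fcoef nu 0 i)); last by apply/funext => i; ring.
  by apply: entireD => //; exact: entireZ.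
rewrite psum_natmul_fcoef mulNr zero_rel.
by field.
Qed.

Variable u : R.
Hypothesis us : u ^+ 2 * s = 1.

Let u_neq0 : u != 0.
Proof.
by apply/eqP => u0; move: us; rewrite u0 expr0n mul0r => /esym/eqP; rewrite oner_eq0.
Qed.

(** Both sides satisfy the same recurrence, and [zero_rel] makes them agree at index 1. The
    condition on [u] fixes it only up to sign, which covers both nodes of a pair. *)
Lemma lommel_at_zero n : u ^+ n * ((lommel nu n).[u] * F 0 s) = F n s.
Proof.
suff: u ^+ n * ((lommel nu n).[u] * F 0 s) = F n s /\
  u ^+ n.+1 * ((lommel nu n.+1).[u] * F 0 s) = F n.+1 s by case.
elim: n => [|n [IH1 IH2]].
  rewrite horner_lommel0 horner_lommel1 !mul1r expr1; split=> //.
  apply: (mulfI (lt0r_neq0 s_gt0)); rewrite zero_rel.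
  by rewrite -[RHS]mulr1 -us; ring.
split; first exact: IH2.
apply: (mulfI (lt0r_neq0 s_gt0)).
rewrite [RHS]psum_fcoef_rec -[F n s]IH1 -[F n.+1 s]IH2.
rewrite horner_lommelSS; transitivity (u ^+ 2 * s * (u ^+ n * (((nu + n.+1%:R) * u *
  (lommel nu n.+1).[u] - (lommel nu n).[u]) * F 0 s))); first by rewrite !exprS; ring.
by rewrite us mul1r !exprS; ring.
Qed.

(** The factorial in the bound for [psum (fcoef n)] beats the geometric growth of [u^-1 ^+ n]. *)
Lemma zero_decays : decays nu u.
Proof.
have F0 := psum_fcoef_neq0.
have rE n : (lommel nu n).[u] = u^-1 ^+ n * F n s / F 0 s.
  rewrite -lommel_at_zero exprVn; field; rewrite F0 /=.
  by rewrite expf_neq0.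
apply/norm_cvg0P.
apply: (@squeeze_cvgr _ _ _ _ (fun=> 0)
  (fun n => expR s / `|F 0 s| * (n%:R * (`|u|^-1 ^+ n / n`!%:R)))).
- near=> n; rewrite normr_ge0 /= rE !normrM normr_nat normfV normrX normfV.
  rewrite [leRHS](_ : _ = n%:R * (`|u|^-1 ^+ n * (n`!%:R^-1 * expR s) / `|F 0 s|)); last by ring.
  rewrite ler_wpM2l// ler_wpM2r ?invr_ge0// ler_wpM2l ?exprn_ge0 ?invr_ge0//.
  exact: psum_fcoef_exp.
- exact: cvg_cst.
- rewrite -[X in _ --> X](mulr0 (expR s / `|F 0 s|)); apply: cvgMr.
  exact: natmul_exp_coeff_cvg0.
Unshelve. all: by end_near. Qed.

End Zero.

End BesselSeries.

(** * The Gamma function *)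

Section GammaFunction.
Variable R : realType.
Implicit Types p t x : R.
Local Open Scope classical_set_scope.
Local Notation mu := (@lebesgue_measure R).

Let g p t : R := t `^ p * expR (- t).
Let e t : R := expR (- (t / 2)).

(** Half of the exponential absorbs the power: [ln y < y] at [y = t / (2 * p)] gives
    [y ^ p <= expR (t / 2)]. The other half remains for integrability. *)
Lemma gamma_density_le p t : 0 < p -> 0 <= t -> g p t <= (2 * p) `^ p * e t.
Proof.
move=> p0; rewrite le_eqVlt => /predU1P[<-|t0].
  by rewrite /g powR0 ?gt_eqF// mul0r mulr_ge0 ?powR_ge0// expR_ge0.
have p2 : 0 < 2 * p by rewrite mulr_gt0.
have tp : 0 < t / (2 * p) by rewrite divr_gt0.
have -> : g p t = (2 * p) `^ p * ((t / (2 * p)) `^ p * expR (- t)).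
  rewrite mulrA -powRM ?(ltW p2) ?(ltW tp)//.
  by rewrite [2 * p * _]mulrC divfK ?gt_eqF.
rewrite ler_wpM2l ?powR_ge0// /powR gt_eqF// -expRD ler_expR.
have := ln_sublinear tp; rewrite -(ltr_pM2l p0) => H.
have E : p * (t / (2 * p)) = t / 2 by field; rewrite gt_eqF.
by move: H; rewrite E => H; lra.
Qed.

Let e_cvg0 : e t @[t --> +oo] --> (0 : R).
Proof.
have half : (t / 2 : R) @[t --> +oo] --> +oo by apply: gt0_cvgMly.
exact: (@cvg_comp _ _ _ (fun t => t / 2) (fun x => expR (- x)) _ _ _ half (@cvgr_expR R)).
Qed.

Let g_cvg0 p : 0 < p -> g p t @[t --> +oo] --> (0 : R).
Proof.
move=> p0; apply: (@squeeze_cvgr _ _ _ _ (fun=> 0) (fun t => (2 * p) `^ p * e t)).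
- near=> t; rewrite gamma_density_le// ?andbT ?mulr_ge0 ?powR_ge0 ?expR_ge0//.
- exact: cvg_cst.
- by rewrite -[X in _ --> X](mulr0 ((2 * p) `^ p)); apply: cvgMr.
Unshelve. all: by end_near. Qed.

Let continuous_e : continuous e.
Proof.
move=> t; apply: continuous_comp; last exact: continuous_expR.
by apply: cvgN; apply: cvgMl.
Qed.

Let is_derive_g p t : 0 < t -> is_derive t 1 (g p) (p * g (p - 1) t - g p t).
Proof.
move=> t0.
have d1 : is_derive t 1 (fun x => x `^ p) (p * t `^ (p - 1)).
  exact: is_derive1_powR.
have d2 : is_derive t 1 (fun x => expR (- x)) (- expR (- t)).
  by apply: is_derive_eq; rewrite mulrN1.
apply: is_derive_eq; rewrite /g /GRing.scale /=; ring.
Qed.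

Let continuous_g p t : 0 < t -> {for t, continuous (g p)}.
Proof.
move=> t0; apply: differentiable_continuous; apply/derivable1_diffP.
by have [] := is_derive_g p t0.
Qed.

Let g_right p : 0 < p -> g p t @[t --> 0^'+] --> g p 0.
Proof.
move=> p0; rewrite /g; apply: cvgM.
  by rewrite powR0 ?gt_eqF//; exact: powR_cvg0.
apply: cvg_at_right_filter; apply: continuous_comp; last exact: continuous_expR.
exact: continuousN.
Qed.

Let is_derive_e t : is_derive t 1 e (- (e t / 2)).
Proof. apply: is_derive_eq; rewrite /e /GRing.scale /=. ring. Qed.

Let integral0y (f F : R -> R) (l : R) : (forall t, 0 <= t -> 0 <= f t) ->
  (forall t, 0 < t -> {for t, continuous f}) -> f t @[t --> 0^'+] --> f 0 ->
  (forall t, 0 < t -> is_derive t 1 F (f t)) -> F t @[t --> 0^'+] --> F 0 ->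
  F t @[t --> +oo] --> l ->
  (\int[mu]_(t in `]0%R, +oo[) (f t)%:E = l%:E - (F 0)%:E)%E.
Proof.
move=> f0 cf cf0 dF cF0 Fl.
have cfw : {within `[0, +oo[, continuous f}.
  apply/continuous_within_itvcyP; split=> // t.
  by rewrite in_itv /= andbT; exact: cf.
rewrite integral_itv_obnd_cbnd; last first.
  apply/measurable_EFinP; apply: measurable_funS (subspace_continuous_measurable_fun _ cfw) => //.
  by apply: subset_itvr; rewrite bnd_simp.
apply: ge0_continuous_FTC2y => //.
- by move=> t /dF[].
- by move=> t; rewrite in_itv /= andbT => /dF[_]; rewrite derive1E.
Qed.

Let measurable_g p D : measurable_fun D (EFin \o g p).
Proof.
apply/measurable_EFinP/measurable_funTS; apply: measurable_funM.
  exact: measurable_powR.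
by apply: measurableT_comp => //; exact: measurable_funN.
Qed.

Let measurable_e c D : measurable_fun D (EFin \o (fun t => c * e t)).
Proof.
apply/measurable_EFinP/measurable_funTS; apply: continuous_measurable_fun => t.
by apply: cvgMr; exact: continuous_e.
Qed.

Let integral_e c : 0 <= c ->
  (\int[mu]_(t in `]0%R, +oo[) (c * e t)%:E = (2 * c)%:E)%E.
Proof.
move=> c0; transitivity (0%:E - (- (2 * c) * e 0)%:E)%E; last first.
  by rewrite /e mul0r oppr0 expR0 mulr1 sub0e EFinN oppeK.
apply: (@integral0y _ (fun t => - (2 * c) * e t)).
- by move=> t _; rewrite mulr_ge0// expR_ge0.
- by move=> t _; apply: cvgMr; exact: continuous_e.
- by apply: cvg_at_right_filter; apply: cvgMr; exact: continuous_e.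
- move=> t _; have de := is_derive_e t.
  by apply: is_derive_eq; rewrite /GRing.scale /=; field.
- by apply: cvg_at_right_filter; apply: cvgMr; exact: continuous_e.
- by rewrite -[X in _ --> X](mulr0 (- (2 * c))); apply: cvgMr.
Qed.

Let I p := (\int[mu]_(t in `]0%R, +oo[) (g p t)%:E)%E.

Let g_ge0 p t : 0 <= g p t.
Proof. by rewrite mulr_ge0 ?powR_ge0// expR_ge0. Qed.

Let I_fin p : 0 < p -> I p \is a fin_num.
Proof.
move=> p0; rewrite ge0_fin_numE; last by apply: integral_ge0 => t _; rewrite lee_fin.
have c0 : 0 <= (2 * p) `^ p by exact: powR_ge0.
apply: (@le_lt_trans _ _ (2 * (2 * p) `^ p)%:E); last exact: ltry.
rewrite -integral_e//; apply: ge0_le_integral => //.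
- by move=> t _; rewrite lee_fin.
- exact: measurable_g.
- exact: measurable_e.
- move=> t /=; rewrite in_itv /= andbT => t0; rewrite lee_fin.
  by apply: gamma_density_le => //; exact: ltW.
Qed.

Let I_gt0 p : 0 < p -> (0 < I p)%E.
Proof.
(* On [[1, 2]], an interval of length 1, the integrand is at least [expR (- 2)]. *)
move=> p0; apply: (@lt_le_trans _ _ (expR (- 2))%:E).
  by rewrite lte_fin expR_gt0.
have -> : ((expR (- 2))%:E = \int[mu]_(t in `[1%R, 2%R]) (expR (- 2))%:E)%E.
  rewrite integral_cst//= lebesgue_measure_itv /= lte_fin ltr1n.
  by rewrite -EFinB -EFinM (_ : 2 - 1 = 1 :> R) ?mulr1//; lra.
apply: (@le_trans _ _ (\int[mu]_(t in `[1%R, 2%R]) (g p t)%:E)%E).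
  apply: ge0_le_integral => //.
  - exact: measurable_g.
  - move=> t /=; rewrite in_itv /= => /andP[t1 t2]; rewrite lee_fin /g.
    rewrite -[leLHS]mul1r; apply: ler_pM => //; rewrite ?expR_ge0//.
      by rewrite -(powRr0 t) ler_powR// ltW.
    by rewrite ler_expR lerN2.
apply: ge0_subset_integral => //.
- exact: measurable_g.
- by move=> t _; rewrite lee_fin.
- move=> t /=; rewrite !in_itv /= andbT => /andP[t1 _]; lra.
Qed.

(* The derivative of [g p] plus a large multiple of [e] is nonnegative, which
   lets the fundamental theorem apply on the half-line. *)
Let I_rec p : 1 < p -> I p = (p%:E * I (p - 1))%E.
Proof.
move=> p1; have p0 : 0 < p by lra. have q0 : 0 < p - 1 by lra.
pose c := (2 * p) `^ p; have c0 : 0 <= c by exact: powR_ge0.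
pose f t := p * g (p - 1) t - g p t + c * e t.
have f0 t : 0 <= t -> 0 <= f t.
  move=> t0; rewrite /f -addrA; apply: addr_ge0.
    by apply: mulr_ge0; [exact: ltW|exact: g_ge0].
  by rewrite addrC subr_ge0 gamma_density_le.
have fcont t : {for t, continuous (g (p - 1))} -> {for t, continuous (g p)} ->
    {for t, continuous f}.
  move=> c1 c2; apply: cvgD; last by apply: cvgMr; exact: continuous_e.
  by apply: cvgB => //; apply: cvgMr.
have intf : (\int[mu]_(t in `]0%R, +oo[) (f t)%:E = (2 * c)%:E)%E.
  transitivity (0%:E - (g p 0 - (2 * c) * e 0)%:E)%E; last first.
    have -> : g p 0 = 0 by rewrite /g powR0 ?mul0r// gt_eqF.
    have -> : e 0 = 1 by rewrite /e mul0r oppr0 expR0.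
    by rewrite mulr1 sub0r sub0e EFinN oppeK.
  apply: (@integral0y _ (fun t => g p t - (2 * c) * e t)) => //.
  - by move=> t t0; apply: fcont; exact: continuous_g.
  - rewrite /f; apply: cvgD; last by apply: cvg_at_right_filter; apply: cvgMr; exact: continuous_e.
    by apply: cvgB; [apply: cvgMr|]; exact: g_right.
  - move=> t t0; have de := is_derive_e t; have dg := is_derive_g p t0.
    by apply: is_derive_eq; rewrite /f /GRing.scale /=; field.
  - apply: cvgB; first exact: g_right.
    by apply: cvg_at_right_filter; apply: cvgMr; exact: continuous_e.
  - rewrite -[X in _ --> X]subr0 -[X in _ --> _ - X](mulr0 (2 * c)).
    by apply: cvgB; [exact: g_cvg0|apply: cvgMr].
have mf D : measurable_fun D (EFin \o f).
  apply/measurable_EFinP; apply: measurable_funD; last first.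
    by apply/measurable_EFinP; exact: measurable_e.
  apply: measurable_funB; last by apply/measurable_EFinP; exact: measurable_g.
  by apply: measurable_funM => //; apply/measurable_EFinP; exact: measurable_g.
(* The identity is arranged so that only nonnegative functions are integrated; the two equal
   integrals [2 * c] then cancel because [I] is finite. *)
have sumE : (\int[mu]_(t in `]0%R, +oo[) (f t)%:E + I p =
    p%:E * I (p - 1) + \int[mu]_(t in `]0%R, +oo[) (c * e t)%:E)%E.
  rewrite /I -ge0_integralD//; first last.
  - exact: measurable_g.
  - by move=> t _; rewrite lee_fin.
  - exact: mf.
  - by move=> t /=; rewrite in_itv /= andbT => /ltW t0; rewrite lee_fin f0.
  rewrite -ge0_integralZl//; first last.
  - by rewrite lee_fin ltW.
  - by move=> t _; rewrite lee_fin.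
  - exact: measurable_g.
  rewrite -[RHS]ge0_integralD//; first last.
  - exact: measurable_e.
  - by move=> t _; rewrite lee_fin mulr_ge0// expR_ge0.
  - by apply: measurable_funeM; exact: measurable_g.
  - by move=> t _; rewrite mule_ge0// lee_fin// ltW.
  by apply: eq_integral => t _; rewrite -EFinM -!EFinD /f; congr EFin; ring.
move: sumE; rewrite intf integral_e// addeC.
rewrite -(fineK (I_fin p0)) -(fineK (I_fin q0)) -EFinM -!EFinD.
by move=> [] /addIr ->.
Qed.

(** For [1 < x] the integrand extends continuously by 0 to the origin; the arguments met later are
    [nu + 1] plus natural numbers. *)
Lemma GammaS x : 1 < x -> Gamma (x + 1) = x * Gamma x.
Proof.
move=> x1; rewrite /Gamma /Rintegral addrK.
rewrite -[X in fine X = _]/(I x) I_rec// fineM ?fineE//.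
by rewrite I_fin//; lra.
Qed.

Lemma Gamma_gt0 x : 1 < x -> 0 < Gamma x.
Proof.
move=> x1; rewrite /Gamma /Rintegral fine_gt0//; have xp : 0 < x - 1 by lra.
by rewrite -/(g _ _) -[X in (_ < X < _)%E]/(I (x - 1)) I_gt0// -ge0_fin_numE ?I_fin// ltW// I_gt0.
Qed.

Lemma Gamma_poch (nu : R) n : 0 < nu ->
  Gamma (n%:R + nu + 1) = \prod_(l < n) (nu + l.+1%:R) * Gamma (nu + 1).
Proof.
move=> nu0; elim: n => [|n IH]; first by rewrite big_ord0 mul1r add0r.
rewrite -natr1 (_ : n%:R + 1 + nu + 1 = n%:R + nu + 1 + 1); last by ring.
rewrite (@GammaS (n%:R + nu + 1)) ?IH.
  by rewrite big_ord_recr /= -natr1; ring.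
by have : 0 <= n%:R :> R by []; lra.
Qed.

End GammaFunction.

(** * The derivative of the Bessel function *)

Section BesselZeros.
Variables (R : realType) (nu : R).
Hypothesis nu_gt0 : 0 < nu.
Local Open Scope classical_set_scope.
Local Notation F s := (psum (fcoef nu 0) s).

Lemma besselJE (x : R) : 0 < x ->
  besselJ nu x = (x / 2) `^ nu * (F (x ^+ 2 / 4) / Gamma (nu + 1)).
Proof.
move=> x0; have x2 : 0 <= x / 2 by lra.
have G0 : Gamma (nu + 1) != 0 by apply/lt0r_neq0/Gamma_gt0; rewrite ltrDr.
rewrite mulrA mulrAC; apply: (cvg_lim (@Rhausdorff R)).
rewrite (_ : series _ = fun N => (x / 2) `^ nu / Gamma (nu + 1) *
    pseries (fcoef nu 0) (x ^+ 2 / 4) N).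
  by apply: cvgMr; apply: psum_cvg; exact: entire_fcoef.
apply/funext => N; rewrite /pseries /series /= mulr_sumr; apply: eq_bigr => m _.
rewrite Gamma_poch// /fcoef add0n -/(poch nu m).
rewrite powRD; last by apply/implyP => _; rewrite gt_eqF//; lra.
rewrite -natrM powR_mulrn// exprM.
have -> : x ^+ 2 / 4 = (x / 2) ^+ 2 by field.
have p := lt0r_neq0 (poch_gt0 nu_gt0 m).
have fi : (m`!)%:R != 0 :> R by rewrite pnatr_eq0 -lt0n fact_gt0.
by field; rewrite G0 p fi.
Qed.

Lemma is_derive_psum (c : nat -> R) (v : R) : entire c ->
  is_derive v 1 (psum c) (psum (pseries_diffs c) v).
Proof.
move=> ec; have e1 : entire (pseries_diffs c) by exact: (entire_shift (entire_natmul ec)).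
have e2 : entire (pseries_diffs (pseries_diffs c)).
  exact: (entire_shift (entire_natmul e1)).
apply: (@pseries_snd_diffs _ _ (`|v| + 1)); try exact: entire_cvg.
by rewrite [ltRHS]ger0_norm ?addr_ge0// ltrDl.
Qed.

Lemma derive1_besselJ (x : R) : 0 < x -> derive1 (besselJ nu) x =
  (x / 2) `^ nu / (x * Gamma (nu + 1)) * psum (bcoef nu) (x ^+ 2 / 4).
Proof.
move=> x0; have x2 : 0 < x / 2 by lra.
have G0 : Gamma (nu + 1) != 0 by apply/lt0r_neq0/Gamma_gt0; rewrite ltrDr.
have ef := @entire_fcoef R nu nu_gt0 0.
pose h (z : R) := (z / 2) `^ nu * (F (z ^+ 2 / 4) / Gamma (nu + 1)).
(* The closed form holds only for positive arguments, hence on a neighbourhood of [x]. *)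
rewrite derive1E (@near_eq_derive _ _ _ _ h)//; last first.
  by near=> z; rewrite besselJE//; near: z; exact: lt_nbhsr.
have d1 : is_derive x 1 (fun z : R => (z / 2) `^ nu) (nu * (x / 2) `^ (nu - 1) / 2).
  have dg : is_derive x 1 (fun z : R => z / 2) (1 / 2).
    by apply: is_derive_eq; rewrite /GRing.scale /=; field.
  have dp := is_derive1_powR nu x2.
  have := @is_derive1_comp _ (fun y => y `^ nu) (fun z : R => z / 2) x _ _ dp dg.
  by rewrite mul1r.
have d2 : is_derive x 1 (fun z : R => F (z ^+ 2 / 4))
    (x / 2 * psum (pseries_diffs (fcoef nu 0)) (x ^+ 2 / 4)).
  have dg : is_derive x 1 (fun z : R => z ^+ 2 / 4) (x / 2).
    by apply: is_derive_eq; rewrite /GRing.scale /=; field.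
  have dp := is_derive_psum (x ^+ 2 / 4) ef.
  have := @is_derive1_comp _ (fun y => F y) (fun z : R => z ^+ 2 / 4) x _ _ dp dg.
  by rewrite mulrC.
have dh : is_derive x 1 h ((nu * (x / 2) `^ (nu - 1) / 2) * (F (x ^+ 2 / 4) / Gamma (nu + 1)) +
  (x / 2) `^ nu * ((x / 2 * psum (pseries_diffs (fcoef nu 0)) (x ^+ 2 / 4)) / Gamma (nu + 1))).
  apply: is_derive_eq; rewrite /GRing.scale /=; ring.
rewrite derive_val psum_bcoef//.
rewrite [psum (fun i => i%:R * _) _]psum_shift ?mul0r ?add0r; last exact: entire_natmul.
rewrite -[psum (fun i => i.+1%:R * _) _]/(psum (pseries_diffs (fcoef nu 0)) _).
have -> : (x / 2) `^ (nu - 1) = (x / 2) `^ nu * (2 / x).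
  rewrite -(mulr_powRB1 (ltW x2) nu_gt0); field.
  by rewrite gt_eqF.
by field; rewrite G0 gt_eqF.
Unshelve. all: by end_near. Qed.

Lemma derive1_besselJ_eq0 (x : R) : 0 < x ->
  derive1 (besselJ nu) x = 0 <-> psum (bcoef nu) (x ^+ 2 / 4) = 0.
Proof.
move=> x0; rewrite derive1_besselJ//; split=> [/eqP|->]; last by rewrite mulr0.
have G0 : 0 < Gamma (nu + 1) by apply: Gamma_gt0; rewrite ltrDr.
have x2 : 0 < x / 2 by lra.
rewrite mulf_eq0 (gt_eqF (divr_gt0 _ _)) ?powR_gt0 ?mulr_gt0//.
by move/eqP.
Qed.

End BesselZeros.

(** * The quadrature formula *)

Section Quadrature.
Variables (R : realType) (nu : R) (s : nat -> R).
Hypothesis nu_gt0 : 0 < nu.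
Hypothesis s_gt0 : forall k, 0 < s k.
Hypothesis s_inc : forall k l, (k < l)%N -> s k < s l.
Hypothesis s_zeros : forall v : R, 0 < v -> psum (bcoef nu) v = 0 <-> exists k, v = s k.
Local Open Scope classical_set_scope.
Local Notation m := (series_quotient (fcoef nu 0) (bcoef nu)).
Local Notation L := (momfun (lmom nu)).
Local Notation kernel := (ckernel (lommel nu) (lommel_norm nu)).

(** With [s k = z ^+ 2 / 4] and [0 < z] this is [2 / z]. *)
Definition node k : R := (Num.sqrt (s k))^-1.
(* the limit of the inverse of the Christoffel-Darboux kernel at [node k] *)
Definition weight k : R := (4 * s k - nu ^+ 2)^-1.

Let s_zero k : psum (bcoef nu) (s k) = 0.
Proof. by apply/s_zeros => //; exists k. Qed.

Lemma node_gt0 k : 0 < node k.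
Proof. by rewrite invr_gt0 sqrtr_gt0. Qed.

Lemma node_sqr k : node k ^+ 2 = (s k)^-1.
Proof. by rewrite exprVn sqr_sqrtr// ltW. Qed.

Lemma node_inj : injective node.
Proof.
have lt k l : (k < l)%N -> node k != node l.
  move=> /s_inc sk; apply/eqP => /(congr1 (fun x => x ^+ 2)).
  by rewrite !node_sqr => /invr_inj skl; rewrite skl ltxx in sk.
move=> k l kl; case: (ltngtP k l) => // /lt; rewrite kl; by rewrite eqxx.
Qed.

Let signed_node (i : nat * bool) : R := if i.2 then - node i.1 else node i.1.

Let signed_node_sqr i : signed_node i ^+ 2 * s i.1 = 1.
Proof.
rewrite /signed_node; case: ifP => _; rewrite ?sqrrN node_sqr mulVf// gt_eqF//.
Qed.

Let signed_node_inj : injective signed_node.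
Proof.
move=> [k e] [l f]; rewrite /signed_node /=; have := node_gt0 k; have := node_gt0 l.
by case: e; case: f => kp lp H; first [move: H => /oppr_inj/node_inj -> |
  move: H => /node_inj -> | exfalso; lra].
Qed.

Let kernel_cvg i : (fun N => (kernel N (signed_node i)).[signed_node i]) @ \oo -->
  4 * s i.1 - nu ^+ 2.
Proof.
have u0 : signed_node i != 0.
  apply/eqP => u0; have := signed_node_sqr i; rewrite u0 expr0n mul0r => /esym/eqP.
  by rewrite oner_eq0.
have -> : 4 * s i.1 = 4 / signed_node i ^+ 2.
  apply: (canRL (mulfK (expf_neq0 2 u0))).
  by rewrite -mulrA [s _ * _]mulrC signed_node_sqr mulr1.
apply: kernel_diag_cvg => //.
by apply: zero_decays (signed_node_sqr i) => //; exact: s_zero.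
Qed.

(** The diagonal kernel at [node k] is at least [nu] from index 1 on, and its limit is
    [4 * s k - nu ^+ 2]. In terms of [z] this gives [nu < z]. *)
Lemma weight_gt0 k : 0 < weight k.
Proof.
rewrite invr_gt0; apply: lt_le_trans nu_gt0 _.
have c := @kernel_cvg (k, false).
rewrite -(cvg_lim _ c)//; apply: limr_ge; first exact: cvgP c.
near=> N; rewrite (_ : N = N.-1.+1); first exact: kernel_diag_ge.
by rewrite prednK//; near: N; exists 1%N.
Unshelve. all: by end_near. Qed.

Lemma momfun_lommel_sum_le K (f : {poly R}) :
  \sum_(0 <= k < K) weight k * (f.[node k] ^+ 2 + f.[- node k] ^+ 2) <= L (f * f).
Proof.
pose y (i : 'I_K * bool) := signed_node (i.1 : nat, i.2).
have y_inj : injective y.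
  by move=> [k e] [l f'] /signed_node_inj [] /val_inj -> ->.
have := @bessel_inequality R (lmom nu) (lommel nu) (lommel_norm nu)
  (size_lommel nu_gt0) (lommel_ortho nu_gt0) (lommel_norm_gt0 nu_gt0)
  ('I_K * bool)%type y (fun i => weight i.1) f (fun i => weight_gt0 i.1).
move=> H; apply: le_trans (H _); last first.
  move=> i k; case: eqVneq => [<-|ik].
    by rewrite /weight mul1r invrK; exact: (@kernel_cvg (i.1 : nat, i.2)).
  rewrite mul0r; apply: kernel_offdiag_cvg.
  - by apply: contraNneq ik => /y_inj ->.
  - by apply: zero_decays (signed_node_sqr _) => //; exact: s_zero.
  - by apply: zero_decays (signed_node_sqr _) => //; exact: s_zero.
rewrite big_mkord.
rewrite -(pair_bigA _ (fun (k : 'I_K) e => weight k * f.[y (k, e)] ^+ 2)) /=.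
by apply: ler_sum => k _; rewrite big_bool /= /y /signed_node /= mulrDr addrC.
Qed.

(** Both nodes of a pair contribute the same amount to an even moment, whence the factor 2. *)
Let kappa k := 2 * weight k.
Local Notation res := (residual s kappa m).

Lemma momfun_residual K (g : {poly R}) : momfun (spread (res K)) g =
  L g - \sum_(0 <= k < K) weight k * (g.[node k] + g.[- node k]).
Proof.
rewrite /momfun.
transitivity (\sum_(i < size g) (g`_i * lmom nu i - \sum_(0 <= k < K)
   weight k * (g`_i * (node k ^+ i + (- node k) ^+ i)))).
  apply: eq_bigr => i _; rewrite /lmom /spread.
  case: ifPn => oi.
    rewrite mulr0 big1 ?subrr// => k _.
    by rewrite exprNn -signr_odd oi mulN1r subrr !mulr0.
  rewrite /residual mulrBr mulr_sumr; congr (_ - _); apply: eq_bigr => k _.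
  have nE : node k ^+ i = (s k)^-1 ^+ i./2.
    by rewrite -{1}(odd_double_half i) (negPf oi) add0n -mul2n exprM node_sqr.
  by rewrite exprNn -signr_odd (negPf oi) mul1r nE /kappa; ring.
rewrite sumrB exchange_big; congr (_ - _); apply: eq_bigr => k _.
rewrite -mulr_sumr; congr (_ * _); rewrite !horner_coef -big_split.
by apply: eq_bigr => i _; rewrite mulrDr.
Qed.

Let quadratic (A B C : R) : (forall a b, 0 <= a * a * A + 2 * (a * b) * B + b * b * C) ->
  0 <= A /\ B ^+ 2 <= A * C.
Proof.
move=> H; have A0 : 0 <= A by have := H 1 0; rewrite !(mul0r, mulr0, mul1r, addr0).
have C0 : 0 <= C by have := H 0 1; rewrite !(mul0r, mulr0, mul1r, add0r).
split=> //; move: A0; rewrite le_eqVlt => /predU1P[A0|A0].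
  (* When [A = 0] this pair evaluates the form to [- (B ^+ 2 * (C + 2))], which forces [B] to
     vanish. *)
  have := H (C + 1) (- B); rewrite -A0 mul0r => H1.
  have : 0 <= - (B ^+ 2 * (C + 2)) by move: H1; congr (is_true (0 <= _)); ring.
  by rewrite oppr_ge0 pmulr_lle0//; lra.
have := H B (- A).
rewrite (_ : _ + _ = A * (A * C - B ^+ 2)); last by ring.
by rewrite pmulr_rge0// subr_ge0.
Qed.

(** Bessel's inequality makes the residual functional nonnegative on squares. Testing it on
    combinations of ['X^r] and ['X^(r.+2)], whose product is the even power between their squares,
    yields a nonnegative quadratic form. *)
Lemma residual_positive K r : 0 <= res K r /\ res K r.+1 ^+ 2 <= res K r * res K r.+2.
Proof.
apply: quadratic => a b; pose f : {poly R} := a *: 'X^r + b *: 'X^(r.+2).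
have -> : a * a * res K r + 2 * (a * b) * res K r.+1 + b * b * res K r.+2 =
    momfun (spread (res K)) (f * f).
  have -> : f * f = (a * a) *: 'X^(r.*2) + (2 * (a * b)) *: 'X^(r.+1.*2) +
      (b * b) *: 'X^(r.+2.*2).
    rewrite /f -!mul_polyC -!muln2 !exprM !exprS !polyCM polyC_natr; ring.
  by rewrite !momfunD !momfunZ !momfunXn !spread_double.
rewrite momfun_residual subr_ge0; apply: le_trans (momfun_lommel_sum_le K f).
by apply: ler_sum => k _; rewrite !hornerM !expr2.
Qed.

Lemma residual0_le K : \sum_(0 <= k < K) kappa k <= m 0%N.
Proof.
have [+ _] := residual_positive K 0; rewrite /residual subr_ge0.
by under eq_bigr do rewrite mulr1.
Qed.

(** If all zeros stayed below [A], every [kappa k] would be at least [1 / (2 * A)], and their sum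
    would exceed the bound [m 0]. *)
Lemma zeros_cvgy : s @ \oo --> +oo.
Proof.
have s_ge k l : (k <= l)%N -> s k <= s l.
  by rewrite leq_eqVlt => /predU1P[->//|/s_inc/ltW].
apply/cvgryPge => A; have [[k Ak]|H] := pselect (exists k, A <= s k).
  by exists k => // l /= kl; apply: le_trans Ak (s_ge _ _ kl).
have sA k : s k < A by rewrite ltNge; apply/negP => Ak; apply: H; exists k.
have A0 : 0 < A by apply: lt_trans (sA 0%N).
pose c : R := (2 * A)^-1; have c0 : 0 < c by rewrite invr_gt0 mulr_gt0.
have kc k : c <= kappa k.
  have w := weight_gt0 k; rewrite /kappa /weight /c.
  have w' : 0 < 4 * s k - nu ^+ 2 by rewrite -invr_gt0.
  rewrite ler_pdivlMr// mulrC ler_pdivrMr ?mulr_gt0//.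
  by have := sA k; have := sqr_ge0 nu; lra.
have bound K : K%:R * c <= m 0%N.
  apply: le_trans (residual0_le K); rewrite mulr_natl -[X in _ *+ X]subn0 -sumr_const_nat.
  exact: ler_sum.
have m0 : 0 <= m 0%N by have := bound 0%N; rewrite mul0r.
exfalso; have := bound (Num.bound (m 0%N / c)); apply/negP; rewrite -ltNge.
by rewrite -ltr_pdivrMr// archi_boundP// divr_ge0// ltW.
Qed.

Lemma residualS_cvg0 r : (fun K => res K r.+1) @ \oo --> (0 : R).
Proof.
have nu0 := lt0r_neq0 nu_gt0.
apply: (@residual_cvg0 R s kappa m (fcoef nu 0) (bcoef nu)).
- exact: entire_fcoef.
- exact: entire_bcoef.
- by rewrite bcoef0.
- by move=> i; apply: series_quotientP; rewrite bcoef0.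
- exact: s_gt0.
- exact: s_inc.
- exact: s_zeros.
- by move=> k; apply: psum_fcoef_neq0.
- move=> k; apply: zero_residue => //.
  by have := weight_gt0 k; rewrite invr_gt0 => /lt0r_neq0.
- by move=> K i; have [] := residual_positive K i.
- by move=> K i; have [] := residual_positive K i.
- by move=> k; rewrite mulr_ge0// ltW// weight_gt0.
- exact: zeros_cvgy.
Qed.

(* No mass is left at the origin because the kernel at [(0, 0)] diverges. *)
Lemma residual0_cvg0 : (fun K => res K 0) @ \oo --> (0 : R).
Proof.
have res0 K : 0 <= res K 0 by have [] := residual_positive K 0.
have resS K : res K.+1 0 <= res K 0.
  rewrite /residual big_nat_recr//= opprD addrA gerDl oppr_le0 mulr1.
  by rewrite mulr_ge0// ltW// weight_gt0.
have rcvg : cvgn (fun K => res K 0).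
  apply: nonincreasing_is_cvgn; first exact/nonincreasing_seqP.
  by exists 0 => _ [K _ <-].
pose c : R := limn (fun K => res K 0).
have rc : (fun K => res K 0) @ \oo --> c by [].
have c0 : 0 <= c by apply: limr_ge => //; near=> K.
suff -> : 0 = c by [].
apply/eqP; rewrite eq_sym eq_le c0 andbT leNgt; apply/negP => cgt0.
(* The test polynomial is the kernel at 0, with value [D] at 0. The limit of the residual functional
   on its square is [c * D ^+ 2], which cannot exceed [L (f * f) = D]. *)
have bound N : c * (kernel N.*2.+1 0).[0] <= 1.
  pose f := kernel N.*2.+1 0; pose D := f.[0]; rewrite -/f -/D.
  have D0 : 0 < D.
    by apply: lt_le_trans (kernel_diag_ge nu_gt0 _ _).
  have LD : L (f * f) = D.
    exact: (momfun_ckernel (lommel_ortho nu_gt0) (lommel_norm_gt0 nu_gt0)).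
  have lim1 : (fun K => momfun (spread (res K)) (f * f)) @ \oo --> c * D ^+ 2.
    have -> : c * D ^+ 2 = \sum_(i < size (f * f)) (f * f)`_i * (c * (i == 0 :> nat)%:R).
      have -> : D ^+ 2 = (f * f)`_0 by rewrite -horner_coef0 hornerM.
      case E : (size (f * f)) => [|n].
        by rewrite big_ord0 nth_default ?E// mulr0.
      rewrite big_ord_recl /= mulr1 big1 ?addr0; first by rewrite mulrC.
      by move=> i _; rewrite mulr0 mulr0.
    apply: cvgr_sum => i _; apply: cvgMr.
    case: (nat_of_ord i) => [|k]; first by rewrite mulr1.
    rewrite /spread /=; case ok : (odd k) => /=; last by rewrite mulr0; exact: cvg_cst.
    case: k ok => //= k _.
    by rewrite mulr0; exact: residualS_cvg0.
  have : c * D ^+ 2 <= D.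
    rewrite -(cvg_lim _ lim1)//; apply: limr_le; first exact: cvgP lim1.
    near=> K; rewrite momfun_residual LD gerBl sumr_ge0// => k _.
    by rewrite mulr_ge0 ?(ltW (weight_gt0 k))// !hornerM addr_ge0// -expr2 sqr_ge0.
  by rewrite expr2 mulrA ger_pMl.
have bd K : K%:R * nu <= c^-1.
  rewrite -[c^-1]mul1r ler_pdivlMr// mulrC; apply: le_trans (bound K).
  by rewrite ler_wpM2l ?(ltW cgt0)// kernel0_ge.
have := bd (Num.bound (c^-1 / nu)); apply/negP; rewrite -ltNge.
by rewrite -ltr_pdivrMr// archi_boundP// divr_ge0 ?invr_ge0// ltW.
Unshelve. all: by end_near. Qed.

Lemma quadrature (g : {poly R}) :
  (fun K => \sum_(0 <= k < K) weight k * (g.[node k] + g.[- node k])) @ \oo --> L g.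
Proof.
have lim0 : (fun K => momfun (spread (res K)) g) @ \oo --> (0 : R).
  have -> : (0 : R) = \sum_(i < size g) g`_i * 0 by rewrite big1// => i _; rewrite mulr0.
  apply: cvgr_sum => i _; apply: cvgMr; rewrite /spread.
  case: (odd i); first exact: cvg_cst.
  by case: (i./2) => [|r]; [exact: residual0_cvg0|exact: residualS_cvg0].
rewrite (_ : (fun _ => _) = fun K => L g - momfun (spread (res K)) g); last first.
  by apply/funext => K; rewrite momfun_residual opprB addrC subrK.
by rewrite -[X in _ --> X]subr0; apply: cvgB => //; exact: cvg_cst.
Qed.

(** Quadrature of the constant 1. It lets the two halves of [momentL] be summed separately. *)
Lemma weight_cvg : cvgn (series weight).
Proof.
rewrite (_ : series weight = fun K => 2^-1 *
  \sum_(0 <= k < K) weight k * ((1 : {poly R}).[node k] + (1 : {poly R}).[- node k])).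
  by apply: is_cvgMr; exact: cvgP (@quadrature 1).
apply/funext => K; rewrite /series /= mulr_sumr; apply: eq_bigr => k _.
by rewrite !hornerC; field.
Qed.

End Quadrature.

(** * The moment functional of the theorem *)

Section MomentL.
Variables (R : realType) (nu : R) (j : int -> R).
Hypothesis nu_gt0 : 0 < nu.
Hypothesis j_zeros : besselJ'_zeros nu j.
Local Open Scope classical_set_scope.
Local Notation L := (momfun (lmom nu)).
Local Notation half := (2^-1 *: 'X : {poly R}).

Let z k := j (k.+1)%:Z.
Let s k : R := z k ^+ 2 / 4.

Let z_zero k : 0 < z k /\ derive1 (besselJ nu) (z k) = 0.
Proof. by case: j_zeros => _ H _; apply/H; exists (k.+1)%:Z. Qed.

Let z_gt0 k : 0 < z k. Proof. by case: (z_zero k). Qed.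

Let z_inc k l : (k < l)%N -> z k < z l.
Proof. by case: j_zeros => H _ _ kl; apply: H => //; rewrite ltz_nat. Qed.

Let s_gt0 k : 0 < s k.
Proof. by rewrite divr_gt0// exprn_gt0. Qed.

Let s_inc k l : (k < l)%N -> s k < s l.
Proof.
move=> kl; rewrite ltr_pM2r ?invr_gt0// ltrXn2r//.
- exact/ltW/z_gt0.
- exact: z_inc.
Qed.

Let s_zeros (v : R) : 0 < v -> psum (bcoef nu) v = 0 <-> exists k, v = s k.
Proof.
move=> v0; split=> [pv|[k ->]]; last first.
  by apply/derive1_besselJ_eq0 => //; case: (z_zero k).
pose x := 2 * Num.sqrt v; have x0 : 0 < x by rewrite mulr_gt0// sqrtr_gt0.
have xv : x ^+ 2 / 4 = v by rewrite exprMn sqr_sqrtr ?ltW//; field.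
have : 0 < x /\ derive1 (besselJ nu) x = 0.
  by split=> //; apply/derive1_besselJ_eq0 => //; rewrite xv.
case: j_zeros => _ H _ /H[[[|k]|k] // k0 xk].
by exists k; rewrite /s /z -xk xv.
Qed.

Let nodeE k : node s k = 2 / z k.
Proof.
rewrite /node /s (_ : z k ^+ 2 / 4 = (z k / 2) ^+ 2); last by field.
by rewrite sqrtr_sqr ger0_norm ?divr_ge0 ?ltW// invf_div.
Qed.

(** Since [4 * s k = z k ^+ 2], the factor is [(z k ^+ 2 - nu ^+ 2) / z k ^+ 2]; it accounts for the
    first factor of [transfer]. *)
Let weightE k : weight nu s k * (1 - nu ^+ 2 / 4 * (2 / z k) ^+ 2) = 1 / z k ^+ 2.
Proof.
have z0 := lt0r_neq0 (z_gt0 k).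
have := weight_gt0 nu_gt0 s_gt0 s_zeros k.
rewrite /weight invr_gt0 => /lt0r_neq0.
have -> : 4 * s k = z k ^+ 2 by rewrite /s; field.
by move=> w0; field; rewrite w0 z0.
Qed.

(* [momentL] lives on the nodes [1 / j'_k], [lmom] on the nodes [2 / j'_k]. *)
Definition transfer (f : {poly R}) : {poly R} :=
  (1 - (nu ^+ 2 / 4) *: 'X^2) * (f \Po half).

Let transferE f x k : x = 1 / z k \/ x = - (1 / z k) ->
  1 / z k ^+ 2 * f.[x] = weight nu s k * (transfer f).[2 * x].
Proof.
move=> xE; rewrite -weightE /transfer hornerM horner_comp hornerZ hornerX mulKf//.
rewrite hornerD hornerN hornerZ hornerXn hornerC [RHS]mulrA.
by case: xE => ->; rewrite ?mulrN ?sqrrN mul1r.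
Qed.

Let termE (f : {poly R}) k : 1 / z k ^+ 2 * f.[1 / z k] = weight nu s k * (transfer f).[node s k].
Proof. by rewrite (transferE f (or_introl erefl)) nodeE mul1r. Qed.

Let termNE (f : {poly R}) k :
  1 / z k ^+ 2 * f.[- (1 / z k)] = weight nu s k * (transfer f).[- node s k].
Proof. by rewrite (transferE f (or_intror erefl)) nodeE mul1r mulrN. Qed.

Let term_cvg (f : {poly R}) : cvgn (series (fun k => 1 / z k ^+ 2 * f.[1 / z k])).
Proof.
pose C := \sum_(i < size f) `|f`_i| * (1 / z 0%N) ^+ i.
have C0 : 0 <= C.
  by apply: sumr_ge0 => i _; rewrite mulr_ge0// exprn_ge0// divr_ge0// ltW.
have zp k : 0 <= 1 / z k by rewrite divr_ge0// ltW.
have zle k : 1 / z k <= 1 / z 0%N.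
  rewrite !div1r lef_pV2// ?posrE//.
  by case: k => // k; exact/ltW/z_inc.
apply: normed_cvg.
apply: (@series_le_cvg _ _ (fun k => C * weight nu s k)) => [k||k|].
- exact: normr_ge0.
- move=> k; rewrite mulr_ge0// ltW//; exact: (weight_gt0 nu_gt0).
- rewrite /= normrM mulrC; apply: ler_pM => //.
    rewrite horner_coef; apply: le_trans (ler_norm_sum _ _ _) _.
    apply: ler_sum => i _; rewrite normrM ler_wpM2l// normrX.
    by rewrite ger0_norm// lerXn2r// ?nnegrE// zle.
  rewrite ger0_norm; last by rewrite divr_ge0// sqr_ge0.
  rewrite -weightE; apply: ler_piMr.
    exact/ltW/(weight_gt0 nu_gt0).
  by rewrite gerBl mulr_ge0 ?sqr_ge0// divr_ge0// sqr_ge0.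
- rewrite (_ : series _ = fun N => C * series (weight nu s) N).
    by apply: is_cvgMr; exact: (weight_cvg nu_gt0 s_gt0 s_inc s_zeros).
  by apply/funext => N; rewrite /series /= mulr_sumr.
Qed.

Let partial_sum (f : {poly R}) :
  (fun K => \sum_(0 <= k < K) 1 / z k ^+ 2 * (f.[1 / z k] + f.[- (1 / z k)])) @ \oo
  --> L (transfer f).
Proof.
have := @quadrature R nu s nu_gt0 s_gt0 s_inc s_zeros (transfer f).
apply: cvg_trans; apply: near_eq_cvg; near=> K; apply: eq_bigr => k _.
by rewrite mulrDr [RHS]mulrDr termE termNE.
Unshelve. all: by end_near. Qed.

Lemma momentLE (f : {poly R}) : momentL j f = L (transfer f).
Proof.
have jN k : j (- k) = - j k by case: j_zeros.
rewrite /momentL.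
(* Reflecting the polynomial turns the sum over negative indices into one over positive indices. *)
pose fN := f \Po (- 'X).
have -> : (fun i : nat => 1 / j (- (i.+1)%:Z) ^+ 2 * f.[1 / j (- (i.+1)%:Z)]) =
    fun k => 1 / z k ^+ 2 * fN.[1 / z k].
  apply/funext => k; rewrite jN sqrrN invrN mulrN /fN.
  by rewrite horner_comp hornerN hornerX.
have cP := @term_cvg f; have cN := @term_cvg fN.
rewrite -limD//; apply: (cvg_lim (@Rhausdorff R)).
have := @partial_sum f.
apply: cvg_trans; apply: near_eq_cvg; near=> K.
rewrite -[RHS]/(series (fun k => 1 / z k ^+ 2 * f.[1 / z k]) K +
  series (fun k => 1 / z k ^+ 2 * fN.[1 / z k]) K) /series /= -big_split.
by apply: eq_bigr => k _; rewrite mulrDr /fN horner_comp hornerN hornerX.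
Unshelve. all: by end_near. Qed.

(** A vanishing sum of nonnegative terms makes [f] vanish at the infinitely many distinct points
    [1 / z k]. *)
Lemma momentL_sqr_eq0 (f : {poly R}) : momentL j (f * f) = 0 -> f = 0.
Proof.
rewrite momentLE => L0; have := @partial_sum (f * f); rewrite L0 => lim0.
pose S K := \sum_(0 <= k < K) 1 / z k ^+ 2 * ((f * f).[1 / z k] + (f * f).[- (1 / z k)]).
have sq x : 0 <= (f * f).[x] by rewrite hornerM -expr2 sqr_ge0.
have t0 k : 0 <= 1 / z k ^+ 2 * ((f * f).[1 / z k] + (f * f).[- (1 / z k)]).
  by rewrite mulr_ge0 ?addr_ge0// divr_ge0// exprn_ge0// ltW.
have S_inc : {homo S : n m / (n <= m)%N >-> n <= m}.
  by apply/nondecreasing_seqP => n; rewrite /S big_nat_recr//= lerDl.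
have S0 K : S K <= 0.
  by rewrite -(cvg_lim _ lim0)//; apply: nondecreasing_cvgn_le => //; exact: cvgP lim0.
have root_z k : root f (1 / z k).
  have : 1 / z k ^+ 2 * ((f * f).[1 / z k] + (f * f).[- (1 / z k)]) <= 0.
    apply: le_trans (S0 k.+1); rewrite /S big_nat_recr//= lerDr.
    by apply: sumr_ge0.
  rewrite pmulr_rle0 ?divr_gt0 ?exprn_gt0// => H.
  have : (f * f).[1 / z k] = 0.
    apply/eqP; rewrite eq_le sq andbT; apply: le_trans H.
    by rewrite lerDl.
  by rewrite hornerM => /eqP; rewrite mulf_eq0 orbb.
apply/eqP; apply: contraT => f0.
have z_inj : injective (fun k => 1 / z k).
  move=> k l; rewrite !div1r => /invr_inj zkl; case: (ltngtP k l) => // /z_inc.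
    by rewrite zkl ltxx.
  by rewrite zkl ltxx.
have := @max_poly_roots _ f [seq 1 / z k | k <- iota 0 (size f)] f0.
rewrite map_inj_uniq// iota_uniq size_map size_iota ltnn.
by move=> -> //; apply/allP => _ /mapP[k _ ->]; exact: root_z.
Qed.

End MomentL.

(** * Rescaling to the polynomials of the theorem *)

Section LommelQ.
Variables (R : realType) (nu : R).
Hypothesis nu_gt0 : 0 < nu.
Local Notation half := (2^-1 *: 'X : {poly R}).

(** The successive factors [2 * (nu + n)] clear the denominators of [beta] and compensate the halved
    variable. *)
Let rf n : R := 2 ^+ n * \prod_(l < n) (nu + l%:R).

Let rfS n : rf n.+1 = 2 * (nu + n%:R) * rf n.
Proof. by rewrite /rf big_ord_recr exprS /=; ring. Qed.

Let nu_neq0 n : nu + n%:R != 0.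
Proof. by rewrite lt0r_neq0// ltr_wpDr. Qed.

Let rf_neq0 n : rf n != 0.
Proof.
elim: n => [|n IH]; first by rewrite /rf big_ord0 mulr1 oner_neq0.
by rewrite rfS; apply: mulf_neq0 => //; apply: mulf_neq0.
Qed.

Lemma lommelE n : lommel nu n = rf n *: (q nu n \Po half).
Proof.
suff: lommel nu n = rf n *: (q nu n \Po half) /\
  lommel nu n.+1 = rf n.+1 *: (q nu n.+1 \Po half) by case.
elim: n => [|n [IH1 IH2]].
  rewrite rfS /rf big_ord0 mulr1 scale1r /= comp_polyC; split=> //.
  rewrite comp_polyZ comp_polyX !scalerA; by congr (_ *: _); rewrite addr0; field.
split; first exact: IH2.
rewrite lommelSS IH1 IH2.
rewrite -[q nu n.+2]/('X * q nu n.+1 - beta nu n.+1 *: q nu n).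
rewrite comp_polyB comp_polyM comp_polyX comp_polyZ scalerBr.
rewrite -!scalerAl -!scalerAr !scalerA; congr (_ *: _ - _ *: _).
  by rewrite !rfS -!natr1; field.
rewrite !rfS /beta -!natr1 addrA addrK; field.
by rewrite -!addrA natr1 !nu_neq0.
Qed.

Lemma horner_q n x : (q nu n).[x] = (rf n)^-1 * (lommel nu n).[2 * x].
Proof. by rewrite lommelE hornerZ horner_comp hornerZ hornerX !mulKf. Qed.

Lemma q_comp_half n : q nu n \Po half = (rf n)^-1 *: lommel nu n.
Proof. by rewrite lommelE scalerA mulVf// scale1r. Qed.

Lemma q_neq0 n : (q nu n).[1 / nu] != 0.
Proof.
rewrite horner_q mulf_neq0 ?invr_eq0//; apply/lt0r_neq0.
(* At [y = 2 / nu] the first two values are 1 and the factor of the recurrence is at least 2, so the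
   values never decrease. *)
apply: lt_le_trans (ltr01) _; set y := 2 * _.
suff: 1 <= (lommel nu n).[y] /\ (lommel nu n).[y] <= (lommel nu n.+1).[y] by case.
have nu0 := lt0r_neq0 nu_gt0.
elim: n => [|n [IH1 IH2]].
  rewrite horner_lommel0 horner_lommel1 /y.
  by rewrite (_ : nu / 2 * _ = 1) ?lexx//; field.
split; first exact: le_trans IH2.
rewrite horner_lommelSS.
have -> : (nu + n.+1%:R) * y = 2 + 2 * (n.+1%:R / nu) by rewrite /y; field.
have n0 : 0 <= n.+1%:R / nu by rewrite divr_ge0// ltW.
have l0 : 0 <= (lommel nu n.+1).[y] by apply: le_trans IH2; apply: le_trans IH1.
by have := mulr_ge0 n0 l0; lra.
Qed.

Lemma horner_qN n x : (q nu n).[- x] = (-1) ^+ n * (q nu n).[x].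
Proof. by rewrite !horner_q mulrN horner_lommelN; ring. Qed.

Lemma size_q n : (size (q nu n) <= n.+1)%N.
Proof.
suff: (size (q nu n) <= n.+1)%N /\ (size (q nu n.+1) <= n.+2)%N by case.
elim: n => [|n [IH1 IH2]].
  by rewrite /= size_poly1 (leq_trans (size_scale_leq _ _))// size_polyX.
split=> //; rewrite -[q nu n.+2]/('X * q nu n.+1 - beta nu n.+1 *: q nu n).
apply: leq_trans (size_polyD _ _) _; rewrite size_polyN geq_max.
apply/andP; split.
  by apply: leq_trans (size_polyMleq _ _) _; rewrite size_polyX.
by apply: leq_trans (size_scale_leq _ _) (leq_trans IH1 _); rewrite ltnW.
Qed.

Lemma lead_q n : (q nu n.+1)`_n.+1 = 2^-1.
Proof.
elim: n => [|n IH]; first by rewrite /= coefZ coefX mulr1.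
rewrite -[q nu n.+2]/('X * q nu n.+1 - beta nu n.+1 *: q nu n).
rewrite coefB coefXM coefZ /= IH [X in _ - _ * X]nth_default ?mulr0 ?subr0//.
exact: leq_trans (size_q n) _.
Qed.

End LommelQ.

(** * Uniqueness of orthogonal polynomials and the Christoffel formula *)

Lemma monic_orthogonal_unique (R : realType) (L : {poly R} -> R)
    (p : nat -> {poly R}) (n : nat) (f : {poly R}) :
  (forall k g h, L (k *: g + h) = k * L g + L h) ->
  (forall g, L (g * g) = 0 -> g = 0) ->
  monic_orthogonal L p -> f \is monic -> size f = n.+1 ->
  (forall d : {poly R}, (size d <= n)%N -> L (f * d) = 0) -> p n = f.
Proof.
move=> L_lin L_def [p_monic p_size p_orth] f_monic f_size f_orth.
have L0 : L 0 = 0.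
  by have := L_lin (-1) 0 0; rewrite scaler0 addr0 mulN1r addNr.
have p_low (d : {poly R}) : (size d <= n)%N -> L (p n * d) = 0.
  move=> /(basis_expansion p_size)[c ->].
  elim/big_ind: _ => [|x y x0 y0|i _]; first by rewrite mulr0.
    by have := L_lin 1 (p n * x) (p n * y); rewrite scale1r -mulrDr x0 y0 mulr0 addr0.
  have := L_lin (c i) (p n * p i) 0; rewrite addr0 L0 addr0 -scalerAr => ->.
  by rewrite p_orth ?mulr0// => /eqP; rewrite gtn_eqF.
(* The leading terms cancel, so the difference is itself a valid test polynomial for both [p n] and
   [f]; [L] therefore vanishes on its square. *)
have d_size : (size (p n - f)%R <= n)%N.
  apply/leq_sizeP => i; rewrite leq_eqVlt => /predU1P[<-|ni]; rewrite coefB.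
    have -> : (p n)`_n = lead_coef (p n) by rewrite lead_coefE p_size.
    have -> : f`_n = lead_coef f by rewrite lead_coefE f_size.
    by rewrite (monicP (p_monic n)) (monicP f_monic) subrr.
  by rewrite !nth_default ?subrr ?p_size ?f_size.
apply/eqP; rewrite -subr_eq0; apply/eqP/L_def.
move: d_size; set d := p n - f => d_size.
have -> : d * d = (-1) *: (f * d) + p n * d.
  by rewrite {1}/d mulrBl scaleN1r addrC.
by rewrite L_lin p_low// f_orth// mulr0 addr0.
Qed.

Theorem theorem3p1 (R : realType) (nu : R) (nu_gt0 : 0 < nu)
    (j : int -> R) (j_zeros : besselJ'_zeros nu j)
    (p : nat -> {poly R}) (p_orth : monic_orthogonal (momentL j) p) (n : nat) :
  (q nu n).[1 / nu] != 0 /\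
  forall x : R, x ^+ 2 != nu ^- 2 ->
    (p n).[x] =
      2 / (q nu n).[1 / nu] *
      (((q nu n).[1 / nu] * (q nu n.+2).[x] - (q nu n).[x] * (q nu n.+2).[1 / nu])
       / (x ^+ 2 - nu ^- 2)).
Proof.
have qn0 := q_neq0 nu_gt0 n; split=> //.
have nu0 := lt0r_neq0 nu_gt0.
(* The constant is chosen so that [T] vanishes at [1 / nu]. As [q n] and [q n.+2] have the same
   parity, [T] also vanishes at [- (1 / nu)] and is divisible by [D]. Its leading coefficient 1/2
   explains the factor 2 in front of the quotient. *)
pose c := (q nu n.+2).[1 / nu] / (q nu n).[1 / nu].
pose T := q nu n.+2 - c *: q nu n.
pose D : {poly R} := 'X^2 - (nu ^- 2)%:P.
have D_monic : D \is monic by rewrite monicXnsubC.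
have D_size : size D = 3%N by rewrite size_XnsubC.
have T_coef : T`_n.+2 = 2^-1.
  have qn : (q nu n)`_n.+2 = 0 by rewrite nth_default// (leq_trans (size_q nu n)).
  by rewrite /T coefB coefZ lead_q qn mulr0 subr0.
have T_size : size T = n.+3.
  apply/eqP; rewrite eqn_leq; apply/andP; split.
    apply: leq_trans (size_polyD _ _) _; rewrite size_polyN geq_max size_q /=.
    apply: leq_trans (size_scale_leq _ _) _.
    by apply: leq_trans (size_q nu n) _; rewrite ltnS ltnW.
  rewrite ltnNge; apply/negP => /leq_sizeP/(_ n.+2 (leqnn _))/eqP.
  by rewrite T_coef invr_eq0 pnatr_eq0.
have T_lead : lead_coef T = 2^-1 by rewrite lead_coefE T_size.
have Tw : T.[1 / nu] = 0.
  by rewrite /T hornerD hornerN hornerZ /c divfK// subrr.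
have TNw : T.[- (1 / nu)] = 0.
  have qn2 := horner_qN nu_gt0 n.+2 (1 / nu); rewrite -signr_odd /= negbK signr_odd in qn2.
  rewrite /T hornerD hornerN hornerZ qn2 horner_qN//.
  by rewrite /c mulrCA divfK// subrr.
have DE : D = \prod_(w <- [:: 1 / nu; - (1 / nu)]) ('X - w%:P).
  rewrite big_cons big_seq1 polyCN opprK -subr_sqr -rmorphXn /=.
  by rewrite div1r exprVn.
have DT : D %| T.
  rewrite DE; apply: uniq_roots_dvdp.
    by rewrite /= /root Tw TNw eqxx.
  rewrite uniq_rootsE /= andbT inE -addr_eq0 -mulr2n -mulr_natl mulf_neq0 ?pnatr_eq0//.
  by rewrite div1r invr_eq0.
pose P := T %/ D.
have TE : T = P * D by rewrite /P divpK.
have two0 : 2 != 0 :> R by rewrite pnatr_eq0.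
have P0 : P != 0.
  by apply/eqP => P0; move: T_size; rewrite TE P0 mul0r size_poly0.
have P_size : size (2 *: P) = n.+1.
  rewrite size_scale//; move: T_size; rewrite TE size_Mmonic// D_size.
  by rewrite addn3 /= => -[].
have P_monic : 2 *: P \is monic.
  by rewrite monicE lead_coefZ -(lead_coef_Mmonic P D_monic) -TE T_lead divff.
(* After halving the variable, the quadratic factor in [transfer] is a multiple of [D], which
   restores [T] from its quotient [P]. Both terms of [T] are orthogonal, for the Lommel functional,
   to polynomials of size at most [n]. *)
have P_orth (d : {poly R}) : (size d <= n)%N -> momentL j ((2 *: P) * d) = 0.
  move=> dn; rewrite (momentLE nu_gt0 j_zeros) /transfer.
  set hf := 2^-1 *: 'X; set d' := d \Po hf.
  have d'n : (size d' <= n)%N.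
    by rewrite /d' size_comp_poly2// size_scale ?size_polyX// invr_eq0.
  have DhE : 1 - (nu ^+ 2 / 4) *: 'X^2 = (- nu ^+ 2) *: (D \Po hf).
    rewrite /D comp_polyB comp_polyC comp_Xn_poly scalerBr exprZn !scalerA.
    have e1 : - nu ^+ 2 * nu ^- 2 = -1 by rewrite mulNr divff ?expf_neq0.
    have e2 : - nu ^+ 2 * 2^-1 ^+ 2 = - (nu ^+ 2 / 4) by field.
    by rewrite -alg_polyC scalerA e1 e2 scaleN1r opprK scaleNr addrC.
  have -> : (1 - (nu ^+ 2 / 4) *: 'X^2) * ((2 *: P * d) \Po hf) =
      (- nu ^+ 2 * 2) *: ((T \Po hf) * d').
    rewrite DhE TE !comp_polyM comp_polyZ -!scalerAl -scalerAr scalerA.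
    by rewrite mulrA [(D \Po hf) * _]mulrC.
  have low m : (size d' <= m)%N -> momfun (lmom nu) ((q nu m \Po hf) * d') = 0.
    move=> dm; rewrite q_comp_half// -scalerAl momfunZ mulrC.
    by rewrite [_ * d']mulrC momfun_lommel_small// mul0r.
  have -> : (T \Po hf) * d' = (q nu n.+2 \Po hf) * d' - c *: ((q nu n \Po hf) * d').
    by rewrite /T comp_polyB comp_polyZ mulrBl scalerAl.
  rewrite momfunZ momfunB momfunZ (low n)// (low n.+2) ?mulr0 ?subrr ?mulr0//.
  by rewrite (leq_trans d'n)// ltnW.
have -> : p n = 2 *: P.
  apply: (@monic_orthogonal_unique _ (momentL j)) => //.
    move=> k g h; rewrite !(momentLE nu_gt0 j_zeros) /transfer.
    by rewrite comp_polyD comp_polyZ mulrDr -scalerAr momfun_linear.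
  by move=> g; exact: (momentL_sqr_eq0 nu_gt0 j_zeros).
move=> x xnu; rewrite hornerZ.
have Dx : D.[x] = x ^+ 2 - nu ^- 2 by rewrite /D hornerD hornerN hornerXn hornerC.
have D0 : x ^+ 2 - nu ^- 2 != 0 by rewrite subr_eq0.
have -> : P.[x] = T.[x] / (x ^+ 2 - nu ^- 2).
  by rewrite -Dx TE hornerM mulfK// Dx.
have -> : T.[x] = (q nu n.+2).[x] - c * (q nu n).[x].
  by rewrite /T hornerD hornerN hornerZ.
by rewrite !mulrA; congr (_ / _); rewrite /c; field.
Qed.
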